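(* Let $\Gamma^2(x_0)=(L,E)$ be the semi-infinite Cayley tree of order $2$ with root $x_0$, let $\mathcal B_x=M_2(\mathbb C)$ for every $x\in L$, and let $\beta\in\mathbb R$. For every edge $\{x,y\}\in E$, with $y$ a direct successor of $x$, put $$K_{<x,y>}=\exp\{\beta P_{<x,y>}\},\qquad P_{<x,y>}=e_{11}^{(x)}\otimes e_{11}^{(y)}+e_{22}^{(x)}\otimes e_{22}^{(y)},$$ and let $h_x=\alpha I$ for every $x\in L$ with $\alpha=\dfrac{4}{(e^{2\beta}+1)^2}$, and $w_0=\dfrac{(e^{2\beta}+1)^2}{4}\,I\in\mathcal B_{x_0}$. Let $\varphi$ be the $d$-Markov chain on $\mathcal B_L$ generated by $(w_0,\{h_x\},\{K_{<x,y>}\})$, i.e. the state with $\varphi(a)=\mathrm{Tr}\big(\mathcal W_{n+1]}(a\otimes\mathbf 1_{W_{n+1}})\big)$ for all $a\in\mathcal B_{\Lambda_n}$, $n\ge0$. Then $\varphi$ is $\gamma_1$- and $\gamma_2$-invariant, i.e. $\varphi\circ\gamma_i=\varphi$ for $i=1,2$, and it satisfies the clustering property with respect to $\gamma_i$, $i=1,2$: for all $a,b\in\mathcal B_L$, $$\lim_{n\to\infty}\varphi(\gamma_i^n(a)b)=\varphi(a)\varphi(b).$$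
   Context: Tree: in $\Gamma^2(x_0)$ every vertex (including the root) has exactly $2$ direct successors. Vertices are finite words $(i_1,\dots,i_n)$ with $i_m\in\{1,2\}$, the root $x_0$ being the empty word; the direct successors of $x=(i_1,\dots,i_n)$ are $(x,i)=(i_1,\dots,i_n,i)$, $i=1,2$, and $E$ consists of the edges $\{x,(x,i)\}$. $W_n$ is the set of vertices at distance $n$ from $x_0$, $\Lambda_n=\bigcup_{m=0}^nW_m$, $E_n$ is the set of edges inside $\Lambda_n$. Algebras: $\mathcal B_\Lambda=\bigotimes_{x\in\Lambda}\mathcal B_x$ for finite $\Lambda$, identified with $\mathcal B_\Lambda\otimes I$ in larger algebras; $\mathcal B_L$ is the $C^*$-inductive limit. $e_{ij}^{(x)}$ are the standard matrix units of $\mathcal B_x=M_2(\mathbb C)$. $\mathrm{Tr}$ is the normalized trace on $\mathcal B_L$, $\mathbf 1_{W_n}=\bigotimes_{y\in W_n}\mathbf 1$. Shifts: for $i=1,2$, $\gamma_i(x)=(i,x)=(i,i_1,\dots,i_n)$ for $x=(i_1,\dots,i_n)$; $\gamma_i$ also denotes the induced unital $*$-endomorphism of $\mathcal B_L$ which maps $\mathcal B_x=M_2(\mathbb C)$ identically onto $\mathcal B_{(i,x)}=M_2(\mathbb C)$. Generated state: with $$\prod_{\{x,y\}\in E_m\setminus E_{m-1}}K_{<x,y>}:=\prod_{x\in W_{m-1}}K_{<x,(x,1)>}K_{<x,(x,2)>}$$ (factors for different $x\in W_{m-1}$ commute; $E_0=\emptyset$), put for $n\ge1$ $$K_n=w_0^{1/2}\prod_{\{x,y\}\in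 E_1}K_{<x,y>}\prod_{\{x,y\}\in E_2\setminus E_1}K_{<x,y>}\cdots\prod_{\{x,y\}\in E_n\setminus E_{n-1}}K_{<x,y>}\prod_{x\in W_n}h_x^{1/2},\qquad\mathcal W_{n]}=K_n^*K_n.$$ For $w_0=\frac{(e^{2\beta}+1)^2}{4}\,I$, $h_x=\frac{4}{(e^{2\beta}+1)^2}\,I$ for every $x\in L$, and $K_{<x,y>}=\exp\{\beta(e_{11}^{(x)}\otimes e_{11}^{(y)}+e_{22}^{(x)}\otimes e_{22}^{(y)})\}$ for every edge $\{x,y\}\in E$ with $y$ a direct successor of $x$, the functionals $a\mapsto\mathrm{Tr}(\mathcal W_{n+1]}(a\otimes\mathbf 1_{W_{n+1}}))$ on $\mathcal B_{\Lambda_n}$ are compatible states and so determine a unique state $\varphi$ on $\mathcal B_L$. *)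

(* Defs.v *)
From HB Require Import structures.
From mathcomp Require Import all_boot all_order all_algebra.
From mathcomp Require Import finmap complex.
From mathcomp Require Import all_classical all_reals all_analysis.
Set Implicit Arguments.
Unset Strict Implicit.
Unset Printing Implicit Defensive.
Import Order.TTheory GRing.Theory Num.Theory.
Import numFieldNormedType.Exports.
Local Open Scope ring_scope.
Local Open Scope complex_scope.
Local Open Scope classical_set_scope.

(* Unital C*-algebras over R[i].  HB refuses to join the normed-module and the
   ring hierarchies after the fact (missing join below numDomainType), so the
   structure is a plain record over a complete normed space, and its carrier
   [cs_sort B] is then equipped with both the normed-module and the algType
   structures, which share their additive group and scaling. *)
Record cstarAlg (R : realType) := CStarAlg {
  cs_mod : completeNormedModType R[i];
  cs_one : cs_mod;
  cs_mul : cs_mod -> cs_mod -> cs_mod;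
  cs_star : cs_mod -> cs_mod;
  cs_mulA : associative cs_mul;
  cs_mul1l : left_id cs_one cs_mul;
  cs_mul1r : right_id cs_one cs_mul;
  cs_mulDl : left_distributive cs_mul +%R;
  cs_mulDr : right_distributive cs_mul +%R;
  cs_one_neq0 : cs_one != 0;
  cs_scaleAl : forall (z : R[i]) a b, z *: cs_mul a b = cs_mul (z *: a) b;
  cs_scaleAr : forall (z : R[i]) a b, z *: cs_mul a b = cs_mul a (z *: b);
  cs_starD : {morph cs_star : a b / a + b};
  cs_starZ : forall (z : R[i]) a, cs_star (z *: a) = Num.conj z *: cs_star a;
  cs_starM : forall a b, cs_star (cs_mul a b) = cs_mul (cs_star b) (cs_star a);
  cs_starK : involutive cs_star;
  cs_normM : forall a b, `|cs_mul a b| <= `|a| * `|b|;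
  cs_norm_star : forall a, `|cs_mul (cs_star a) a| = `|a| ^+ 2
}.

Definition cs_sort (R : realType) (B : cstarAlg R) : Type := cs_mod B.
Coercion cs_sort : cstarAlg >-> Sortclass.

HB.instance Definition _ (R : realType) (B : cstarAlg R) :=
  CompleteNormedModule.copy (cs_sort B) (cs_mod B).
HB.instance Definition _ (R : realType) (B : cstarAlg R) :=
  GRing.Zmodule_isNzRing.Build (cs_sort B) (@cs_mulA R B) (@cs_mul1l R B)
    (@cs_mul1r R B) (@cs_mulDl R B) (@cs_mulDr R B) (@cs_one_neq0 R B).
HB.instance Definition _ (R : realType) (B : cstarAlg R) :=
  GRing.Lmodule_isLalgebra.Build R[i] (cs_sort B) (@cs_scaleAl R B).
HB.instance Definition _ (R : realType) (B : cstarAlg R) :=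
  GRing.Lalgebra_isAlgebra.Build R[i] (cs_sort B) (@cs_scaleAr R B).

Definition star (R : realType) (B : cstarAlg R) (a : B) : B := cs_star a.

Definition cexp (R : realType) (B : cstarAlg R) (a : B) : B :=
  limn (series (fun k : nat => (k`!%:R : R[i])^-1 *: a ^+ k)).

Record is_state (R : realType) (B : cstarAlg R) (phi : {scalar B}) : Prop := {
  state_pos : forall a : B, 0 <= phi (star a * a);
  state_one : phi 1 = 1
}.

(* The labels 1, 2 are represented by 0, 1 : 'I_2, both for the letters of the
   words below and for the matrix indices. The direct successors of x are
   [rcons x i]. *)
Definition vertex : choiceType := seq 'I_2.

Definition W (n : nat) : {fset vertex} :=
  [fset (tval x : vertex) | x in {: n.-tuple 'I_2}]%fset.

Definition Lambda (n : nat) : {fset vertex} := \big[fsetU/fset0]_(m < n.+1) W m.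

Definition config (V : {fset vertex}) : finType := {ffun V -> 'I_2}.

(* B_V, the tensor product of the M_2(C) over x in V, as the matrices indexed
   by the canonical basis { e_s : s in config V } of the tensor product of the
   C^2 over x in V. *)
Definition locAlg (R : realType) (V : {fset vertex}) : Type :=
  'M[R[i]]_#|config V|.

Definition restr (V V' : {fset vertex}) (VV' : (V `<=` V')%fset)
    (s : config V') : config V := [ffun x => s (fincl VV' x)].

(* a |-> a (x) I, from B_V to B_V' *)
Definition ampl (R : realType) (V V' : {fset vertex}) (VV' : (V `<=` V')%fset)
    (a : locAlg R V) : locAlg R V' :=
  \matrix_(p, q)
    let s := enum_val p : config V' in
    let t := enum_val q : config V' in
    if [forall x : V', (val x \notin V) ==> (s x == t x)]
    then a (enum_rank (restr VV' s)) (enum_rank (restr VV' t)) else 0.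

(* the identification of M_2(C) with B_{x} *)
Definition site_mx (R : realType) (x : vertex) (m : 'M[R[i]]_2) :
    locAlg R [fset x]%fset :=
  \matrix_(p, q) m ((enum_val p : config _) [` fset11 x]%fset)
                   ((enum_val q : config _) [` fset11 x]%fset).

(* (B, iota) is the C*-inductive limit of the B_V; an injective unital
   *-homomorphism out of the matrix algebra B_V is automatically isometric. *)
Record is_inductive_limit (R : realType) (B : cstarAlg R)
    (iota : forall V : {fset vertex}, locAlg R V -> B) : Prop := {
  iota_linear : forall V (z : R[i]) (a b : locAlg R V),
    iota V (z *: a + b) = z *: iota V a + iota V b;
  iota_mul : forall V (a b : locAlg R V), iota V (a *m b) = iota V a * iota V b;
  iota_one : forall V, iota V 1%:M = 1;
  iota_star : forall V (a : locAlg R V),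
    iota V (map_mx Num.conj a^T) = star (iota V a);
  iota_inj : forall V, injective (iota V);
  iota_ampl : forall V V' (VV' : (V `<=` V')%fset) (a : locAlg R V),
    iota V' (ampl VV' a) = iota V a;
  iota_dense : dense (\bigcup_V range (iota V))
}.

Section QuasiLocal.
Variables (R : realType) (B : cstarAlg R).
Variable iota : forall V : {fset vertex}, locAlg R V -> B.

Definition at_site (x : vertex) (m : 'M[R[i]]_2) : B :=
  iota (site_mx x m).

Record is_normalized_trace (Tr : {scalar B}) : Prop := {
  trace_state : is_state Tr;
  trace_loc : forall V (a : locAlg R V), Tr (iota a) = \tr a / #|config V|%:R
}.

Record is_shift (i : 'I_2) (gamma : {lrmorphism B -> B}) : Prop := {
  shift_star : forall a : B, gamma (star a) = star (gamma a);
  shift_site : forall x (m : 'M[R[i]]_2),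
    gamma (at_site x m) = at_site (i :: x) m
}.

Definition psd (m : 'M[R[i]]_2) : Prop :=
  forall v : 'rV[R[i]]_2, 0 <= (v *m m *m map_mx Num.conj v^T) 0 0.

(* m^(1/2), for m positive semidefinite *)
Definition sqrtm (m : 'M[R[i]]_2) : 'M[R[i]]_2 :=
  xget 0 [set r | psd r /\ r *m r = m].

(* P_<x,y>; the tensor product of elements of B_{x} and B_{y}, x != y, is the
   product in B of their images. *)
Definition edge_proj (x y : vertex) : B :=
  at_site x (delta_mx 0 0) * at_site y (delta_mx 0 0)
  + at_site x (delta_mx 1 1) * at_site y (delta_mx 1 1).

Section Chain.
Variables (w0 : 'M[R[i]]_2) (h : vertex -> 'M[R[i]]_2).
Variable K : vertex -> vertex -> B.

Definition Kn (n : nat) : B :=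
  at_site [::] (sqrtm w0)
  * \prod_(m < n) \prod_(x : W m)
      (K (val x) (rcons (val x) 0) * K (val x) (rcons (val x) 1))
  * \prod_(x : W n) at_site (val x) (sqrtm (h (val x))).

Definition calW (n : nat) : B := star (Kn n) * Kn n.

Record is_markov_chain (Tr phi : {scalar B}) : Prop := {
  chain_state : is_state phi;
  chain_loc : forall n (a : locAlg R (Lambda n)),
    phi (iota a) = Tr (calW n.+1 * iota a)
}.

End Chain.
End QuasiLocal.

(* Main.v *)
Require Import Defs.
From mathcomp Require Import all_boot all_order all_algebra.
From mathcomp Require Import finmap complex.
From mathcomp Require Import all_classical all_reals all_analysis.
From mathcomp Require Import ring lra.
Import Order.TTheory GRing.Theory Num.Theory.
Import numFieldNormedType.Exports.
Local Open Scope ring_scope.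
Local Open Scope complex_scope.
Local Open Scope classical_set_scope.
Set Implicit Arguments.
Unset Strict Implicit.
Unset Printing Implicit Defensive.

(** Write [s_x] for the spin [diag(1,-1)] at the vertex [x].  The projection on
an edge is [(1 + s_x s_y)/2], so the square of the edge weight is a constant
times [1 + theta s_x s_y] with [theta = (e^(2 beta) - 1)/(e^(2 beta) + 1)], which
is [tanh beta].  All these elements commute, and [h] and [w0] are scalars, so
the density of the chain is a constant times the product [G_n] of the factors
[1 + theta s_x s_y] over the edges down to level [n].  The trace of such a factor
over its lower end is 1; hence [G_n] has trace 1, the constant is 1 because
[phi 1 = 1], and [phi b = Tr (b G_n)] for every [b] living on the levels up to
[n] ([markov_chain_gibbs]).

A leaf can now be integrated out.  If [y] is a child of [x] and [b] lives on
vertices other than [y] that are not below the level of [y], then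
[phi (b m_y) = phi (b (T m)_x)], where the transfer map [T] on 2 by 2 matrices
fixes the identity, multiplies [diag(1,-1)] by [theta] and kills the off-diagonal
entries ([leaf_removal], [trace_leaf_removal]).  Removing the leaves of a local
element one after the other moves it to the root: for each local [a] there is a
matrix [m] at the root such that [psi a = psi m] for all additive functionals
[psi] that satisfy the leaf removal rule ([reduce_to_root]).  The matrix depends
on [a] only.

Let [b] live on the levels up to [N].  Far down the tree [b] does not interfere
with leaf removal, so for [n > N] the functional [a |-> phi (gamma^n a b)]
obeys the rule too, and its value at [a] is the one for the matrix [m] at the
vertex [i^n].  Leaf removal along the path from [i^n] up to [i^N] replaces [m] by
[T^(n-N) m], which is [tr m / 2] plus a multiple of [theta^(n-N)] of the spin
([shifted_correlation]).  As [tr m / 2 = phi a] and [|theta| < 1], the limit is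
[phi a phi b].  For [b = 1] and [N = 0] the correction is a multiple of
[phi s_root = 0], which is the invariance.

It remains to pass from local elements to all of them by density.  States are
bounded because [1 - x] is of the form [y^* y] for small self-adjoint [x]
([one_sub_is_square], [state_bound]).  The correlations are bounded uniformly in
[n] by a Cauchy-Schwarz inequality, in which invariance removes the shift
([correlation_bound]). *)

(** * Limits of complex numbers *)

Lemma half_power_lt (R : realType) (e : R[i]) : 0 < e ->
  exists N, forall n, (N <= n)%N -> (2^-1 : R[i]) ^+ n < e.
Proof.
case: e => a b; rewrite ltcE /= => /andP[/eqP b0 a0].
have a1 : 0 <= a^-1 by rewrite invr_ge0 ltW.
exists (Num.bound a^-1) => n Nn.
have -> : (2^-1 : R[i]) ^+ n = ((2^-1 : R) ^+ n)%:C.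
  by rewrite rmorphXn fmorphV rmorph_nat.
have -> : a +i* b = a%:C by rewrite b0.
rewrite ltcR exprVn -[ltRHS]invrK ltf_pV2 ?posrE ?invr_gt0 ?exprn_gt0//.
apply: lt_le_trans (archi_boundP a1) _; rewrite -natrX ler_nat.
by apply: leq_trans Nn _; apply: ltnW; apply: ltn_expl.
Qed.

(** The choice [e = |a| / (C + 1)] gives [(C + 1) |a| <= C |a|]. *)
Lemma norm_eq0_eps (R : realType) (V : normedZmodType R[i]) (C : R[i]) (a : V) :
  0 <= C -> (forall e : R[i], 0 < e -> `|a| <= C * e) -> a = 0.
Proof.
move=> C0 aC; apply/eqP; rewrite -normr_le0.
case: (eqVneq a 0) => [->|a0]; first by rewrite normr0.
have C1 : 0 < C + 1 by rewrite ltr_wpDl.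
have := aC (`|a| / (C + 1)); rewrite divr_gt0 ?normr_gt0// => /(_ isT).
rewrite mulrA ler_pdivlMr// mulrDr mulr1 mulrC.
by rewrite -lerBrDl subrr.
Qed.

Lemma norm_realC (R : realType) (r : R) : `|r%:C| = `|r|%:C.
Proof. by rewrite normc_def /= expr0n addr0 sqrtr_sqr. Qed.

Lemma cvg_realC (R : realType) (u : nat -> R) (l : R) :
  u @ \oo --> l -> (fun n => (u n)%:C : R[i]^o) @ \oo --> (l%:C : R[i]^o).
Proof.
move=> ul; apply/cvgrPdist_lt => -[e e'].
rewrite ltcE /= => /andP[/eqP -> e0].
have /cvgrPdist_lt/(_ e e0) := ul.
case=> N _ HN; exists N => // n /= Nn.
by have := HN n Nn; rewrite /= -rmorphB/= norm_realC ltcR.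
Qed.

(** A uniform limit of convergent sequences converges.  The constant [C] absorbs
the norm of the element that stays fixed in a bilinear expression. *)
Lemma cvg_approx (R : realType) (u : nat -> R[i]) (l C : R[i]) : 0 <= C ->
  (forall e : R[i], 0 < e -> exists (v : nat -> R[i]) (k : R[i]),
    [/\ (v : nat -> R[i]^o) @ \oo --> (k : R[i]^o),
        forall n, `|u n - v n| <= C * e & `|l - k| <= C * e]) ->
  (u : nat -> R[i]^o) @ \oo --> (l : R[i]^o).
Proof.
move=> C0 approx; apply/cvgrPdist_lt => e e0.
have C1 : 0 < 2 * C + 1 by rewrite ltr_wpDl// mulr_ge0.
have [|v [k [vk uv lk]]] := approx (e / (2 * C + 1)); first by rewrite divr_gt0.
have /cvgrPdist_lt/(_ (e / (2 * C + 1))) := vk.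
rewrite divr_gt0// => /(_ isT); apply: filterS => n /= kv.
have -> : l - u n = (l - k) + ((k - v n) - (u n - v n)) by ring.
rewrite (le_lt_trans (ler_normD _ _))//.
have -> : e = C * (e / (2 * C + 1)) + (e / (2 * C + 1) + C * (e / (2 * C + 1))).
  by field; rewrite gt_eqF.
rewrite ler_ltD// (le_lt_trans (ler_normB _ _))// ltr_leD//.
Qed.

(** * States on a C*-algebra are bounded *)

Section CstarAlgebra.
Variables (R : realType) (B : cstarAlg R).
Implicit Types a b x y : B.

Lemma starD a b : star (a + b) = star a + star b.
Proof. exact: cs_starD. Qed.
Lemma starM a b : star (a * b) = star b * star a.
Proof. exact: cs_starM. Qed.
Lemma starZ (z : R[i]) a : star (z *: a) = Num.conj z *: star a.
Proof. exact: cs_starZ. Qed.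
Lemma starK a : star (star a) = a.
Proof. exact: cs_starK. Qed.
Lemma star1 : star (1 : B) = 1.
Proof. by rewrite -[LHS]mulr1 -[X in _ * X]starK -starM mulr1 starK. Qed.
Lemma star0 : star (0 : B) = 0.
Proof. by rewrite -(scale0r 0) starZ rmorph0 !scale0r. Qed.
Lemma starN a : star (- a) = - star a.
Proof. by rewrite -scaleN1r starZ rmorphN1 scaleN1r. Qed.
Lemma starB a b : star (a - b) = star a - star b.
Proof. by rewrite starD starN. Qed.
Lemma cstar_normM a b : `|a * b| <= `|a| * `|b|.
Proof. exact: cs_normM. Qed.
Lemma norm_starM a : `|star a * a| = `|a| ^+ 2.
Proof. exact: cs_norm_star. Qed.
Lemma norm_star a : `|star a| = `|a|.
Proof.
suff le b : `|b| <= `|star b|.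
  by apply/le_anti; rewrite le andbT; have := le (star a); rewrite starK.
have [->|b0] := eqVneq b 0; first by rewrite normr0.
by rewrite -(@ler_pM2r _ `|b|) ?normr_gt0// -expr2 -norm_starM cstar_normM.
Qed.

(** A square root of [1 - x] of the form [1 - y] satisfies [y = (x + y^2)/2].  On
the ball of radius 1/4 the right-hand side is a contraction with ratio at most
1/4, so its iterates from 0 converge; they are self-adjoint, and so is the
limit. *)
Section SquareRoot.
Variable x : B.
Hypotheses (x_sa : star x = x) (x_le : `|x| <= 4^-1).

Let f y := 2^-1 *: (x + y * y).
Let u n := iter n f 0.
Let norm_half : `|2^-1 : R[i]| = 2^-1.
Proof. by rewrite ger0_norm// invr_ge0. Qed.

Let f_le y : `|y| <= 4^-1 -> `|f y| <= 4^-1.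
Proof.
move=> ly; rewrite /f normrZ norm_half.
apply: (@le_trans _ _ (2^-1 * (4^-1 + 4^-1 * 4^-1))).
  rewrite ler_wpM2l ?invr_ge0// (le_trans (ler_normD _ _))// lerD//.
  by rewrite (le_trans (cstar_normM _ _))// ler_pM.
have -> : 2^-1 * (4^-1 + 4^-1 * 4^-1) = 4^-1 - 32^-1 *3 :> R[i] by field.
by rewrite gerBl mulr_ge0 ?invr_ge0.
Qed.

Let f_lip y z : `|f y - f z| <= 2^-1 * (`|y| + `|z|) * `|y - z|.
Proof.
rewrite /f -scalerBr normrZ norm_half -mulrA ler_wpM2l ?invr_ge0//.
have -> : x + y * y - (x + z * z) = y * (y - z) + (y - z) * z.
  by rewrite mulrBr mulrBl addrA subrK opprD addrACA subrr add0r.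
rewrite (le_trans (ler_normD _ _))// [leRHS]mulrDl lerD ?cstar_normM//.
by rewrite mulrC cstar_normM.
Qed.

Let u_le n : `|u n| <= 4^-1.
Proof. by elim: n => [|n IH]; rewrite /u/= ?normr0 ?invr_ge0// f_le. Qed.

Let u_sa n : star (u n) = u n.
Proof.
elim: n => [|n IH]; first exact: star0.
rewrite /u/= /f starZ starD starM x_sa IH; congr (_ *: _).
by rewrite fmorphV rmorph_nat.
Qed.

Let u_cauchy n k : `|u (n + k)%N - u n| <= 2^-1 ^+ n.
Proof.
elim: n => [|n IH].
  by rewrite add0n subr0 expr0 (le_trans (u_le _))// invf_le1// ler1n.
rewrite addSn exprS /u /= -!/(u _) (le_trans (f_lip _ _))// ler_pM//.
rewrite ler_piMr ?invr_ge0// (le_trans (lerD (u_le _) (u_le _)))//.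
have -> : 4^-1 + 4^-1 = 2^-1 :> R[i] by field.
by rewrite invf_le1// ler1n.
Qed.

Let u_cvg : cvgn u.
Proof.
apply/cauchy_cvgP/cauchy_exP => e e0.
have [N HN] := half_power_lt e0.
exists (u N); exists N => // n /= Nn.
rewrite -ball_normE /= distrC (le_lt_trans _ (HN N _))//.
by rewrite -(subnKC Nn).
Qed.

Lemma one_sub_is_square : exists y, star y * y = 1 - x.
Proof.
pose y := limn u.
have uy e : 0 < e -> exists2 n, `|y - u n| <= e & `|y - u n.+1| <= e.
  move=> e0; have /cvgrPdist_le/(_ e e0)[N _ HN] : u @ \oo --> y by exact: u_cvg.
  by exists N; apply: HN => //=.
have y_sa : star y = y.
  apply/eqP; rewrite -subr_eq0; apply/eqP/(@norm_eq0_eps _ _ 2) => // e e0.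
  have [n un _] := uy _ e0.
  have -> : star y - y = star (y - u n) - (y - u n).
    by rewrite starB u_sa opprB addrA subrK.
  rewrite (le_trans (ler_normB _ _))// norm_star mulr_natl mulr2n lerD//.
have y_fix : y = f y.
  apply/eqP; rewrite -subr_eq0; apply/eqP.
  apply/(@norm_eq0_eps _ _ (1 + 2^-1 * (4^-1 + `|y|))) => [|e e0].
    by rewrite addr_ge0// mulr_ge0 ?invr_ge0// addr_ge0// invr_ge0.
  have [n un un1] := uy _ e0.
  have -> : y - f y = (y - u n.+1) + (f (u n) - f y) by rewrite addrA subrK.
  rewrite (le_trans (ler_normD _ _))// mulrDl mul1r lerD//.
  rewrite (le_trans (f_lip _ _))// ler_pM//.
  - by rewrite ler_wpM2l ?invr_ge0// lerD2r.
  - by rewrite distrC.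
exists (1 - y); rewrite starB star1 y_sa.
have yx : x + y * y = y + y.
  rewrite {3 4}y_fix /f -scalerDl.
  have -> : 2^-1 + 2^-1 = 1 :> R[i] by field.
  by rewrite scale1r.
rewrite mulrBr mulr1 mulrBl mul1r.
by rewrite -[in RHS](addrK (y * y) x) yx !opprD !opprK !addrA.
Qed.
End SquareRoot.

Section States.
Variable phi : {scalar B}.
Hypothesis phi_state : is_state phi.

Let phiZ (z : R[i]) x : phi (z *: x) = z * phi x.
Proof. exact: linearZ. Qed.

(** Both [1 - x] and [1 + x] are positive, so [phi x] lies between -1 and 1. *)
Lemma state_selfadjoint_small x : star x = x -> `|x| <= 4^-1 -> `|phi x| <= 1.
Proof.
move=> x_sa x_le.
have [y yE] := one_sub_is_square x_sa x_le.
have nx_sa : star (- x) = - x by rewrite starN x_sa.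
have [|z zE] := one_sub_is_square nx_sa; first by rewrite normrN.
have := state_pos phi_state y; rewrite yE linearB (state_one phi_state)/= => h1.
have := state_pos phi_state z.
rewrite zE opprK linearD (state_one phi_state)/= => h2.
have xr : phi x \is Num.real.
  by rewrite -(@rpredDl _ _ 1) ?ger0_real// ger0_real.
rewrite real_ler_norml//; apply/andP; split; last by rewrite -subr_ge0.
by rewrite -subr_ge0 opprK addrC.
Qed.

Lemma state_selfadjoint_bound x : star x = x -> `|phi x| <= 4 * `|x|.
Proof.
move=> x_sa; have [->|x0] := eqVneq x 0.
  by rewrite linear0 !normr0 mulr0.
have nx : 0 < 4 * `|x| by rewrite mulr_gt0 ?normr_gt0.
pose t := (4 * `|x|)^-1.
have t0 : 0 < t by rewrite invr_gt0.
have tx : `|t *: x| <= 4^-1.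
  by rewrite normrZ gtr0_norm// /t invfM mulfVK ?normr_eq0.
have tx_sa : star (t *: x) = t *: x.
  by rewrite starZ x_sa (CrealP _)// ger0_real// ltW.
have := state_selfadjoint_small tx_sa tx.
by rewrite linearZ/= normrM gtr0_norm// ler_pdivrMl// mulr1.
Qed.

(** The constant 8 comes from the splitting of [2 x] into two self-adjoint
elements of norm at most [2 |x|], each of which contributes a factor 4. *)
Lemma state_bound x : `|phi x| <= 8 * `|x|.
Proof.
have i2 : 'i * 'i = -1 :> R[i] by rewrite -expr2 sqrCi.
pose p := x + star x; pose q := 'i *: (x - star x).
have p_sa : star p = p by rewrite starD starK addrC.
have q_sa : star q = q by rewrite starZ starB starK conjCi scaleNr -scalerN opprB.
have np : `|p| <= 2 * `|x|.
  by rewrite (le_trans (ler_normD _ _))// norm_star mulr_natl mulr2n.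
have nq : `|q| <= 2 * `|x|.
  rewrite normrZ normCi mul1r (le_trans (ler_normB _ _))//.
  by rewrite norm_star mulr_natl mulr2n.
have xE : 2 *: x = p - 'i *: q.
  rewrite scalerA i2 scaleN1r opprK /p addrACA subrr addr0.
  by rewrite scaler_nat mulr2n.
rewrite -(@ler_pM2l _ 2)// -{1}[2](@ger0_norm R[i])// -normrM -linearZ/= xE.
rewrite linearB linearZ/= (le_trans (ler_normB _ _))// normrM normCi mul1r.
rewrite (le_trans (lerD (state_selfadjoint_bound p_sa)
  (state_selfadjoint_bound q_sa)))// -mulrDr.
rewrite (le_trans (ler_wpM2l _ (lerD np nq)))//.
by have -> : 2 * (8 * `|x|) = 4 * (2 * `|x| + 2 * `|x|) by ring.
Qed.

(** Polarization: with [u = star x], [4 u^* y] is the sum of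
[c^* (u + c y)^* (u + c y)] over the four fourth roots of unity [c].  This weak
form of the Cauchy-Schwarz inequality gives the usual bound, up to a constant,
after both elements are normalized. *)
Lemma state_Schwarz x y :
  `|phi (x * y)| <= phi (x * star x) + phi (star y * y).
Proof.
pose u := star x.
pose Q c := phi (star (u + c *: y) * (u + c *: y)).
set p := phi (x * star x); set r := phi (star y * y); set m := phi (x * y).
have QE c : Q c = p + c * m + Num.conj c * phi (star y * u) + Num.conj c * c * r.
  rewrite /Q starD starZ starK mulrDl !mulrDr -!scalerAl -!scalerAr !linearD/=.
  by rewrite !phiZ -[phi (x * u)]/p -/m -/r !addrA.
have Q0 c : `|Q c| = Q c by rewrite ger0_norm// state_pos.
have [I [i2 ic ni]] : exists I : R[i], [/\ I * I = -1, Num.conj I = - I & `|I| = 1].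
  by exists 'i%R; split; [rewrite -expr2 sqrCi | exact: conjCi | exact: normCi].
have nic : Num.conj (- I) = I by rewrite rmorphN/= ic opprK.
have n1c : Num.conj (-1) = -1 :> R[i] by rewrite rmorphN1.
have mE : 4 * m = Q 1 - I * Q I - Q (-1) + I * Q (- I).
  by rewrite !QE nic ic n1c rmorph1; ring: i2.
have prE : 4 * (p + r) = Q 1 + Q I + Q (-1) + Q (- I).
  by rewrite !QE nic ic n1c rmorph1; ring: i2.
rewrite -(@ler_pM2l _ 4)// -{1}[4](@ger0_norm R[i])// -normrM mE prE.
rewrite (le_trans (ler_normD _ _))// normrM ni mul1r Q0 lerD2r.
rewrite (le_trans (ler_normB _ _))// Q0 lerD2r.
by rewrite (le_trans (ler_normB _ _))// normrM ni mul1r !Q0.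
Qed.

End States.
End CstarAlgebra.

(** * Adding one site to a matrix algebra of configurations *)

Section LocalMatrices.
Variable R : realType.
Implicit Types U V : {fset vertex}.

(** Matrices are indexed by ranks of configurations; indexing the entries by the
configurations themselves turns matrix products and traces into sums over
configurations. *)
Definition entry V (a : locAlg R V) (s t : config V) : R[i] :=
  a (enum_rank s) (enum_rank t).

Definition of_entries V (F : config V -> config V -> R[i]) : locAlg R V :=
  \matrix_(p, q) F (enum_val p) (enum_val q).

Lemma entry_of_entries V (F : config V -> config V -> R[i]) s t :
  entry (of_entries F) s t = F s t.
Proof. by rewrite /entry mxE !enum_rankK. Qed.

Lemma entry_ext V (a b : locAlg R V) :
  (forall s t, entry a s t = entry b s t) -> a = b.
Proof.
by move=> ab; apply/matrixP => p q; have := ab (enum_val p) (enum_val q);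
  rewrite /entry !enum_valK.
Qed.

Lemma sum_config V (F : 'I_#|config V| -> R[i]) :
  \sum_p F p = \sum_(s : config V) F (enum_rank s).
Proof. by rewrite (reindex enum_rank)//; apply/onW_bij/enum_rank_bij. Qed.

Lemma entryM V (a b : locAlg R V) s t :
  entry (a *m b) s t = \sum_u entry a s u * entry b u t.
Proof. by rewrite /entry mxE sum_config. Qed.

Lemma entryZ V z (a : locAlg R V) s t :
  entry (z *: a) s t = z * entry a s t.
Proof. by rewrite /entry mxE. Qed.

Lemma entry1 V s t : entry (1%:M : locAlg R V) s t = (s == t)%:R.
Proof. by rewrite /entry mxE (inj_eq enum_rank_inj). Qed.

Lemma trace_entries V (a : locAlg R V) : \tr a = \sum_s entry a s s.
Proof. by rewrite /mxtrace sum_config. Qed.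

Lemma entry_ampl V V' (VV' : (V `<=` V')%fset) (a : locAlg R V) s t :
  entry (ampl VV' a) s t =
  if [forall x : V', (val x \notin V) ==> (s x == t x)]
  then entry a (restr VV' s) (restr VV' t) else 0.
Proof. by rewrite /entry mxE !enum_rankK. Qed.

Lemma entry_site x (m : 'M[R[i]]_2) s t :
  entry (site_mx x m) s t = m (s [` fset11 x]%fset) (t [` fset11 x]%fset).
Proof. by rewrite /entry mxE !enum_rankK. Qed.

Section AddSite.
Variables (y : vertex) (U : {fset vertex}).
Hypothesis yU : y \notin U.
Let V := (y |` U)%fset.
Let UV : (U `<=` V)%fset := fsubsetU1 y U.
Let yV : V := [` fset1U1 y U]%fset.
Let sub1V : ([fset y] `<=` V)%fset.
Proof. by rewrite fsub1set fset1U1. Qed.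

Definition extend (s : config U) (k : 'I_2) : config V :=
  [ffun x => if insub (val x) is Some u then s u else k].

Lemma restr_extend s k : restr UV (extend s k) = s.
Proof.
apply/ffunP => u; rewrite !ffunE /= insubT ?fsvalP// => uU.
by congr (s _); apply: val_inj.
Qed.

Lemma extend_site s k : extend s k yV = k.
Proof. by rewrite ffunE /= insubN. Qed.

Lemma extend_restr s : extend (restr UV s) (s yV) = s.
Proof.
apply/ffunP => x; rewrite ffunE; case: insubP => [u _ ux|].
  by rewrite ffunE; congr (s _); apply: val_inj.
move=> xU; congr (s _); apply: val_inj => /=.
by have := fsvalP x; rewrite !inE (negPf xU) orbF => /eqP.
Qed.

(** A configuration on [y |` U] is a configuration on [U] together with a label
at [y]. *)
Lemma sum_extend (F : config V -> R[i]) :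
  \sum_s F s = \sum_w \sum_k F (extend w k).
Proof.
rewrite pair_big /= (reindex (fun p => extend p.1 p.2))//.
exists (fun s => (restr UV s, s yV)) => [[w k]|s] _ /=.
  by rewrite restr_extend extend_site.
exact: extend_restr.
Qed.

(** The tensor product of [a] with [m] placed at the new site [y]. *)
Definition add_site (a : locAlg R U) (m : 'M[R[i]]_2) : locAlg R V :=
  of_entries (fun s t =>
    entry a (restr UV s) (restr UV t) * m (s yV) (t yV)).

Lemma entry_ampl_old (a : locAlg R U) s t :
  entry (ampl UV a) s t =
  (s yV == t yV)%:R * entry a (restr UV s) (restr UV t).
Proof.
rewrite entry_ampl; case: (eqVneq (s yV) (t yV)) => st.
  rewrite mul1r; case: forallP => // -[] x; apply/implyP => xU.
  suff -> : x = yV by rewrite st.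
  apply: val_inj => /=.
  by have := fsvalP x; rewrite !inE (negPf xU) orbF => /eqP.
rewrite mul0r; case: forallP => // /(_ yV).
by rewrite /= yU (negPf st).
Qed.

Lemma entry_ampl_new (m : 'M[R[i]]_2) s t :
  entry (ampl sub1V (site_mx y m)) s t =
  (restr UV s == restr UV t)%:R * m (s yV) (t yV).
Proof.
rewrite entry_ampl entry_site.
have restr1 (w : config V) : restr sub1V w [` fset11 y]%fset = w yV.
  by rewrite ffunE; congr (w _); apply: val_inj.
rewrite !restr1; case: (eqVneq (restr UV s) (restr UV t)) => st.
  rewrite mul1r; case: forallP => // -[] x; apply/implyP => xy.
  have xU : val x \in U.
    by have := fsvalP x; rewrite !inE; move: xy; rewrite inE => /negPf ->.
  have := congr1 (fun w : config U => w [` xU]%fset) st; rewrite !ffunE.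
  have -> : fincl UV [` xU]%fset = x by apply: val_inj.
  by move=> ->.
rewrite mul0r; case: forallP => // H; case/eqP: st.
apply/ffunP => u; rewrite !ffunE.
have /implyP/(_ _)/eqP -> // := H (fincl UV u).
rewrite inE/=; apply: contraNneq yU => <-; exact: fsvalP.
Qed.

(** In the sum over intermediate configurations only one term survives: the one
that agrees with the left index at [y] and with the right index on [U]. *)
Lemma ampl_mul_site a m :
  ampl UV a *m ampl sub1V (site_mx y m) = add_site a m.
Proof.
apply: entry_ext => s t; rewrite entryM entry_of_entries.
rewrite (bigD1 (extend (restr UV t) (s yV)))//= big1 => [|u].
  rewrite entry_ampl_old entry_ampl_new restr_extend extend_site !eqxx.
  by rewrite !mul1r addr0.
rewrite entry_ampl_old entry_ampl_new => ne.
case: eqVneq => [su|]; last by rewrite !mul0r.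
case: eqVneq => [ut|]; last by rewrite mul0r mulr0.
by case/eqP: ne; rewrite -ut su extend_restr.
Qed.

Lemma site_mul_ampl a m :
  ampl sub1V (site_mx y m) *m ampl UV a = add_site a m.
Proof.
apply: entry_ext => s t; rewrite entryM entry_of_entries.
rewrite (bigD1 (extend (restr UV s) (t yV)))//= big1 => [|u].
  rewrite entry_ampl_old entry_ampl_new restr_extend extend_site !eqxx.
  by rewrite !mul1r addr0 mulrC.
rewrite entry_ampl_old entry_ampl_new => ne.
case: eqVneq => [su|]; last by rewrite !mul0r.
case: eqVneq => [ut|]; last by rewrite mul0r mulr0.
by case/eqP: ne; rewrite su -ut extend_restr.
Qed.

Lemma trace_add_site a m : \tr (add_site a m) = \tr a * \tr m.
Proof.
rewrite !trace_entries sum_extend mulr_suml; apply: eq_bigr => w _.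
rewrite /mxtrace mulr_sumr; apply: eq_bigr => k _.
by rewrite entry_of_entries restr_extend extend_site.
Qed.

Lemma card_config_add : #|config V| = (#|config U| * 2)%N.
Proof.
by rewrite !card_ffun card_ord -!cardfE cardfsU1 yU add1n expnS mulnC.
Qed.

(** The decomposition of a matrix on [y |` U] into blocks indexed by the labels at
[y]. *)
Lemma add_site_decomp (a : locAlg R V) :
  a = \sum_k \sum_l
    add_site (of_entries (fun s t => entry a (extend s k) (extend t l)))
             (delta_mx k l).
Proof.
apply: entry_ext => s t; rewrite /entry summxE.
transitivity (\sum_k \sum_l (entry a (extend (restr UV s) k)
    (extend (restr UV t) l) * delta_mx k l (s yV) (t yV))); last first.
  apply: eq_bigr => k _; rewrite summxE; apply: eq_bigr => l _.
  by rewrite -/(entry _ s t) !entry_of_entries.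
rewrite (bigD1 (s yV))//= (bigD1 (t yV))//= !extend_restr mxE !eqxx mulr1.
rewrite !big1 ?addr0// => [k ks|l lt].
  by rewrite big1// => l _; rewrite mxE eq_sym (negPf ks) mulr0.
by rewrite mxE [_ == l]eq_sym (negPf lt) andbF mulr0.
Qed.

End AddSite.

Lemma config1_eq x (s t : config [fset x]%fset) :
  (s == t) = (s [` fset11 x]%fset == t [` fset11 x]%fset).
Proof.
apply/eqP/eqP => [-> //|st]; apply/ffunP => u.
suff -> : u = [` fset11 x]%fset by [].
by apply: val_inj => /=; have := fsvalP u; rewrite inE => /eqP.
Qed.

Lemma site_mxM x (m m' : 'M[R[i]]_2) :
  site_mx x (m *m m') = site_mx x m *m site_mx x m'.
Proof.
apply: entry_ext => s t; rewrite entry_site entryM mxE.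
rewrite (reindex (fun u : config [fset x]%fset => u [` fset11 x]%fset)).
  by apply: eq_bigr => u _; rewrite !entry_site.
exists (fun k => [ffun => k]) => [u|k] _; last by rewrite ffunE.
by apply/eqP; rewrite config1_eq ffunE.
Qed.

Lemma site_mxP x z (m m' : 'M[R[i]]_2) :
  site_mx x (z *: m + m') = z *: site_mx x m + site_mx x m'.
Proof. by apply/matrixP => p q; rewrite !mxE. Qed.

Lemma site_mx1 x : site_mx x (1%:M : 'M[R[i]]_2) = 1%:M.
Proof.
by apply: entry_ext => s t; rewrite entry_site entry1 config1_eq mxE.
Qed.

Lemma site_mx_adj x (m : 'M[R[i]]_2) :
  site_mx x (map_mx Num.conj m^T) = map_mx Num.conj (site_mx x m)^T.
Proof. by apply/matrixP => p q; rewrite !mxE. Qed.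

(** A configuration on one site is constant, which identifies the algebra of the
site with the 2 by 2 matrices. *)
Lemma site_mx_onto x (a : locAlg R [fset x]%fset) :
  exists m : 'M[R[i]]_2, a = site_mx x m.
Proof.
exists (\matrix_(k, l) entry a [ffun => k] [ffun => l]).
apply: entry_ext => s t; rewrite entry_site mxE.
by congr entry; apply/eqP; rewrite config1_eq ffunE.
Qed.

End LocalMatrices.

(** * Local elements, spins and the shifts *)

Definition pauliZ (R : realType) : 'M[R[i]]_2 := delta_mx 0 0 - delta_mx 1 1.

Section Localization.
Variables (R : realType) (B : cstarAlg R).
Variable iota : forall V : {fset vertex}, locAlg R V -> B.
Hypothesis iota_lim : is_inductive_limit iota.
Variable Tr : {scalar B}.
Hypothesis Tr_trace : is_normalized_trace iota Tr.
Implicit Types (x y : vertex) (m : 'M[R[i]]_2) (P Q : set vertex) (a b c : B).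
Local Notation at_ := (at_site iota).
Local Notation "'s_' x" := (at_site iota x (pauliZ R)) (at level 8, x at level 2).

Let iotaD V (u v : locAlg R V) : iota (u + v) = iota u + iota v.
Proof. by have := iota_linear iota_lim 1 u v; rewrite !scale1r. Qed.
Let iota0 V : iota (0 : locAlg R V) = 0.
Proof.
have /eqP := iotaD (0 : locAlg R V) 0.
by rewrite addr0 -subr_eq subrr eq_sym => /eqP.
Qed.
Let iotaZ V z (u : locAlg R V) : iota (z *: u) = z *: iota u.
Proof. by have := iota_linear iota_lim z u 0; rewrite iota0 !addr0. Qed.
Let iota_sum V (I : finType) (F : I -> locAlg R V) :
  iota (\sum_i F i) = \sum_i iota (F i).
Proof. exact: (big_morph _ (@iotaD V) (@iota0 V)). Qed.

Lemma at_linear x z m m' : at_ x (z *: m + m') = z *: at_ x m + at_ x m'.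
Proof. by rewrite /at_site site_mxP (iota_linear iota_lim). Qed.
Lemma atD x m m' : at_ x (m + m') = at_ x m + at_ x m'.
Proof. by rewrite -[m]scale1r at_linear !scale1r. Qed.
Lemma at0 x : at_ x 0 = 0.
Proof.
have /eqP := atD x 0 0.
by rewrite addr0 -subr_eq subrr eq_sym => /eqP.
Qed.
Lemma atZ x z m : at_ x (z *: m) = z *: at_ x m.
Proof. by rewrite -[_ *: _]addr0 at_linear at0 addr0. Qed.
Lemma atM x m m' : at_ x (m *m m') = at_ x m * at_ x m'.
Proof. by rewrite /at_site site_mxM (iota_mul iota_lim). Qed.
Lemma at1 x : at_ x 1%:M = 1.
Proof. by rewrite /at_site site_mx1 (iota_one iota_lim). Qed.
Lemma at_star x m : star (at_ x m) = at_ x (map_mx Num.conj m^T).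
Proof. by rewrite /at_site site_mx_adj (iota_star iota_lim). Qed.

Definition floc (V : {fset vertex}) b := exists a : locAlg R V, b = iota a.
(** Locality is expressed by a condition [P] on vertices instead of a finite set,
since supports are described below by levels and by excluded vertices. *)
Definition loc P b := exists2 V, (forall v, v \in V -> P v) & floc V b.

Lemma flocS V V' b : (V `<=` V')%fset -> floc V b -> floc V' b.
Proof.
move=> VV' [a ->]; exists (ampl VV' a).
by rewrite (iota_ampl iota_lim).
Qed.

Lemma locS P Q b : P `<=` Q -> loc P b -> loc Q b.
Proof. by move=> PQ [V VP Vb]; exists V => // v /VP/PQ. Qed.

Lemma loc_common_support P b c : loc P b -> loc P c ->
  exists2 V, (forall v, v \in V -> P v) & floc V b /\ floc V c.
Proof.
move=> [V VP Vb] [W WP Wc]; exists (V `|` W)%fset.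
  by move=> v; rewrite inE => /orP[/VP|/WP].
by split; [apply: flocS Vb; exact: fsubsetUl | apply: flocS Wc; exact: fsubsetUr].
Qed.

Lemma locD P b c : loc P b -> loc P c -> loc P (b + c).
Proof.
move=> Pb Pc; have [V VP [[u ->] [v ->]]] := loc_common_support Pb Pc.
by exists V => //; exists (u + v).
Qed.
Lemma locM P b c : loc P b -> loc P c -> loc P (b * c).
Proof.
move=> Pb Pc; have [V VP [[u ->] [v ->]]] := loc_common_support Pb Pc.
by exists V => //; exists (u *m v); rewrite (iota_mul iota_lim).
Qed.
Lemma locZ P z b : loc P b -> loc P (z *: b).
Proof. by move=> [V VP [u ->]]; exists V => //; exists (z *: u). Qed.
Lemma loc1 P : loc P 1.
Proof. by exists fset0 => //; exists 1%:M; rewrite (iota_one iota_lim). Qed.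
Lemma loc_sum P (I : finType) (F : I -> B) :
  (forall i, loc P (F i)) -> loc P (\sum_i F i).
Proof.
move=> PF; elim/big_ind: _ => //; last exact: locD.
by rewrite -(scale0r 1); apply/locZ/loc1.
Qed.
Lemma loc_at P x m : P x -> loc P (at_ x m).
Proof.
by move=> Px; exists [fset x]%fset => [v /fset1P->//|]; exists (site_mx x m).
Qed.

Lemma add_site_iota y U (a : locAlg R U) m : y \notin U ->
  iota (add_site y a m) = iota a * at_ y m /\
  iota (add_site y a m) = at_ y m * iota a.
Proof.
move=> yU; split; first by rewrite -ampl_mul_site// (iota_mul iota_lim)
  !(iota_ampl iota_lim).
by rewrite -site_mul_ampl// (iota_mul iota_lim) !(iota_ampl iota_lim).
Qed.

(** With [a] on [V] and [y] outside [V], both products are the tensor product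
[add_site]. *)
Lemma at_comm P y m b : loc P b -> ~ P y -> b * at_ y m = at_ y m * b.
Proof.
move=> [V VP [a ->]] Py.
have yV : y \notin V by apply/negP => /VP.
by have [<- <-] := add_site_iota a m yV.
Qed.

Lemma trace_at P y m b : loc P b -> ~ P y ->
  Tr (b * at_ y m) = Tr b * (\tr m / 2).
Proof.
move=> [V VP [a ->]] Py.
have yV : y \notin V by apply/negP => /VP.
have [<- _] := add_site_iota a m yV.
rewrite !(trace_loc Tr_trace) trace_add_site//.
rewrite [X in _ / X%:R](card_config_add yV) natrM.
by rewrite invfM mulrACA.
Qed.

Lemma trace_comm P b c : loc P b -> loc P c -> Tr (b * c) = Tr (c * b).
Proof.
move=> Pb Pc; have [V _ [[u ->] [v ->]]] := loc_common_support Pb Pc.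
by rewrite -!(iota_mul iota_lim) !(trace_loc Tr_trace) mxtrace_mulC.
Qed.

(** The one-site decomposition that drives all inductions on supports. *)
Lemma floc_decomp V y b : y \in V -> floc V b ->
  exists2 f : 'I_2 -> 'I_2 -> B, (forall k l, floc (V `\ y)%fset (f k l)) &
    b = \sum_k \sum_l f k l * at_ y (delta_mx k l).
Proof.
move=> yV; rewrite -{1}(fsetD1K yV) => -[a ->].
have yU : y \notin (V `\ y)%fset by rewrite !inE eqxx.
move: (V `\ y)%fset yU a => U yU a.
pose f k l : locAlg R U :=
  of_entries (fun s t => entry a (extend y s k) (extend y t l)).
exists (fun k l => iota (f k l)) => [k l|]; first by exists (f k l).
rewrite [in LHS](add_site_decomp a) iota_sum; apply: eq_bigr => k _.
rewrite iota_sum; apply: eq_bigr => l _.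
by have [-> _] := add_site_iota (f k l) (delta_mx k l) yU.
Qed.

Lemma floc0 b : floc fset0 b -> exists z : R[i], b = z *: 1.
Proof.
move=> [a ->].
have empty (s t : config fset0) : s = t.
  by apply/ffunP => -[x x0]; exfalso; rewrite inE in x0.
exists (entry a [ffun => 0] [ffun => 0]).
rewrite -(iota_one iota_lim fset0) -iotaZ; congr (iota _).
apply: entry_ext => s t; rewrite entryZ entry1 (empty s t) eqxx mulr1.
by congr entry; apply: empty.
Qed.

Lemma floc1 x b : floc [fset x]%fset b -> exists m, b = at_ x m.
Proof. by move=> [a ->]; have [m ->] := site_mx_onto a; exists m. Qed.

Lemma loc_dense a (e : R[i]) : 0 < e -> exists2 b, loc setT b & `|a - b| < e.
Proof.
move=> e0.
have aO : interior (ball a e) a by exact: nbhsx_ballx.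
have [|b [/interior_subset ab [V _ [u _ ub]]]] :=
    iota_dense iota_lim (ex_intro _ a aO).
  exact: open_interior.
exists b; first by exists V => //; exists u.
by move: ab; rewrite -ball_normE.
Qed.

(** A local element is a combination of products of one-site elements, and on
these the shift is known; the sites are split off one at a time. *)
Lemma shift_floc i (gamma : {lrmorphism B -> B}) : is_shift iota i gamma ->
  forall V b, floc V b ->
  loc [set v | exists2 x, x \in V & v = i :: x] (gamma b).
Proof.
move=> g_shift V; elim/finSet_rect: V => V IH b Vb.
case: (fset_0Vmem V) => [V0|[y yV]].
  move: Vb; rewrite V0 => /floc0[z ->]; rewrite linearZ rmorph1/=.
  exact/locZ/loc1.
have [f fV ->] := floc_decomp yV Vb.
rewrite raddf_sum; apply: loc_sum => k; rewrite raddf_sum; apply: loc_sum => l.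
rewrite /= rmorphM/= (shift_site g_shift); apply: locM.
  apply: (@locS [set v | exists2 x, x \in (V `\ y)%fset & v = i :: x]).
    by move=> v [x]; rewrite !inE => /andP[_ xV] ->; exists x.
  by apply: IH => //; exact: fproperD1.
by apply: loc_at; exists y.
Qed.

(** The real algebra generated by the spins of the sites in [P].  It contains all
the weights of the chain; that its elements commute and are self-adjoint follows
by induction on their construction. *)
Inductive spin_alg P : B -> Prop :=
| spin_alg1 : spin_alg P 1
| spin_alg_site x : P x -> spin_alg P (s_ x)
| spin_algD b c : spin_alg P b -> spin_alg P c -> spin_alg P (b + c)
| spin_algM b c : spin_alg P b -> spin_alg P c -> spin_alg P (b * c)
| spin_algZ (r : R) b : spin_alg P b -> spin_alg P (r%:C *: b).

Lemma spin_alg_loc P b : spin_alg P b -> loc P b.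
Proof.
elim=> [|x Px|{}b c _ Pb _ Pc|{}b c _ Pb _ Pc|r {}b _ Pb].
- exact: loc1.
- exact: loc_at.
- exact: locD.
- exact: locM.
- exact: locZ.
Qed.

Lemma spin_algS P Q b : P `<=` Q -> spin_alg P b -> spin_alg Q b.
Proof.
move=> PQ; elim=> [|x Px|{}b c _ Pb _ Pc|{}b c _ Pb _ Pc|r {}b _ Pb].
- exact: spin_alg1.
- exact/spin_alg_site/PQ.
- exact: spin_algD.
- exact: spin_algM.
- exact: spin_algZ.
Qed.

Lemma spin_comm x y : s_ x * s_ y = s_ y * s_ x.
Proof.
have [->//|/eqP xy] := eqVneq x y.
by apply: (@at_comm [set x]) => [|/= yx]; [exact: loc_at | exact: xy].
Qed.

Lemma spin_alg_comm P Q b c : spin_alg P b -> spin_alg Q c -> b * c = c * b.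
Proof.
move=> Pb; elim=> [|y Qy|{}c d _ Pc _ Pd|{}c d _ Pc _ Pd|r {}c _ Pc].
- by rewrite mulr1 mul1r.
- elim: Pb => [|x Px|{}b c' _ IHb _ IHc|{}b c' _ IHb _ IHc|r {}b _ IH].
  + by rewrite mulr1 mul1r.
  + exact: spin_comm.
  + by rewrite mulrDl mulrDr IHb IHc.
  + by rewrite -mulrA IHc mulrA IHb mulrA.
  + by rewrite -scalerAl -scalerAr IH.
- by rewrite mulrDl mulrDr Pc Pd.
- by rewrite mulrA Pc -mulrA Pd mulrA.
- by rewrite -scalerAl -scalerAr Pc.
Qed.

Lemma spin_star x : star (s_ x) = s_ x.
Proof.
rewrite at_star; congr at_site; apply/matrixP => k l; rewrite !mxE.
by rewrite rmorphB/= !rmorph_nat ![(l == _) && _]andbC.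
Qed.

Lemma spin_sqr x : s_ x * s_ x = 1.
Proof.
rewrite -atM -(at1 x); congr at_site; rewrite /pauliZ.
rewrite mulmxBl !mulmxBr !mul_delta_mx_cond !eqxx/= !mulr1n !mulr0n.
rewrite subr0 sub0r opprK; apply/matrixP => k l; rewrite !mxE.
by case: k l => [[|[|]]//] ? [[|[|]]//] ?; rewrite ?addr0 ?add0r.
Qed.

Lemma spin_alg_star P b : spin_alg P b -> star b = b.
Proof.
elim=> [|x Px|{}b c _ Pb _ Pc|{}b c Pb sb Pc sc|r {}b _ Pb].
- exact: star1.
- exact: spin_star.
- by rewrite starD Pb Pc.
- by rewrite starM sb sc (spin_alg_comm Pc Pb).
- rewrite starZ Pb; congr (_ *: _).
  exact: conjc_real.
Qed.

End Localization.

(** * Square roots, exponentials and Gibbs products on the tree *)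

(** The square root is picked by choice among positive semidefinite roots, so its
value has to be pinned down by uniqueness.  If [r] is such a root of [s^2] with
[s > 0], then [(r + s)(r - s) = 0], and [r + s] is injective because
[v r v^* = - s v v^*] forces [v = 0]. *)
Lemma sqrtm_scalar (R : realType) (c : R) : 0 < c ->
  sqrtm ((c%:C)%:M) = ((Num.sqrt c)%:C)%:M :> 'M[R[i]]_2.
Proof.
move=> c0; set s := (Num.sqrt c)%:C.
have s0 : 0 < s by rewrite ltcR sqrtr_gt0.
have ss : s * s = c%:C by rewrite -rmorphM -expr2 sqr_sqrtr// ltW.
have norm_ge0 (v : 'rV[R[i]]_2) k : 0 <= v 0 k * Num.conj (v 0 k).
  by rewrite -normCK exprn_ge0.
have formE (v : 'rV[R[i]]_2) (z : R[i]) :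
    (v *m z%:M *m map_mx Num.conj v^T) 0 0
    = z * \sum_k v 0 k * Num.conj (v 0 k).
  rewrite mul_mx_scalar -scalemxAl mxE; congr (_ * _).
  by rewrite mxE; apply: eq_bigr => k _; rewrite !mxE.
have psd_s : psd (s%:M : 'M[R[i]]_2).
  by move=> v; rewrite formE mulr_ge0 ?(ltW s0)// sumr_ge0.
have sq_s : s%:M *m s%:M = (c%:C)%:M :> 'M[R[i]]_2.
  by rewrite -scalar_mxM ss.
rewrite /sqrtm; case: xgetP => [r _ [psd_r sq_r]|/(_ s%:M)[]//].
have inj : row_free (r + s%:M).
  rewrite -kermx_eq0; apply/rowV0P => v /sub_kermxP; rewrite mulmxDr => vr0.
  have vr : v *m r = - (v *m s%:M) by apply/eqP; rewrite -addr_eq0 vr0.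
  have := psd_r v; rewrite vr mulNmx mxE formE oppr_ge0.
  rewrite pmulr_rle0// => sum_le0.
  have /psumr_eq0P/(_ _) : \sum_k v 0 k * Num.conj (v 0 k) = 0.
    by apply/le_anti; rewrite sum_le0 sumr_ge0.
  move=> v0; apply/rowP => k; rewrite mxE; apply/eqP.
  rewrite -normr_eq0 -sqrf_eq0 normCK; apply/eqP; exact: v0.
apply/eqP; rewrite -subr_eq0; apply/eqP.
apply: (row_free_inj inj).
rewrite mul0mx mulmxDr !mulmxBl sq_r sq_s.
by rewrite -scalar_mxC addrA subrK subrr.
Qed.

(** All positive powers of [p] equal [p], so the partial sums are affine in the
partial sums of the real exponential. *)
Lemma cexp_idempotent (R : realType) (B : cstarAlg R) (t : R) (p : B) :
  p * p = p -> cexp (t%:C *: p) = 1 + (expR t - 1)%:C *: p.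
Proof.
move=> pp; apply: cvg_lim => //.
have partial n : series (fun k => (k`!%:R : R[i])^-1 *: (t%:C *: p) ^+ k) n.+1
    = 1 + (series (exp_coeff t) n.+1 - 1)%:C *: p.
  elim: n => [|n IH].
    rewrite /series/= !big_nat1 /exp_coeff/= !expr0 fact0 divr1 subrr.
    by rewrite scale0r addr0 invr1 scale1r.
  have seriesSr (V : zmodType) (u : nat -> V) k :
      series u k.+1 = series u k + u k by rewrite /series/= big_nat_recr.
  rewrite seriesSr IH [in RHS]seriesSr [in RHS]addrAC [in RHS]rmorphD.
  rewrite [in RHS]scalerDl addrA; congr (_ + _); rewrite exprZn scalerA.
  have -> : p ^+ n.+1 = p by elim: n {IH} => // n IH; rewrite exprS IH.
  congr (_ *: _); rewrite /exp_coeff/= rmorphM fmorphV rmorph_nat rmorphXn.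
  by rewrite mulrC.
rewrite -cvg_shiftS; under eq_fun do rewrite partial.
apply: cvgD; first exact: cvg_cst.
apply: cvgZr_tmp; apply: cvg_realC; apply: cvgB; last exact: cvg_cst.
by rewrite (cvg_shiftS (series (exp_coeff t))); exact: is_cvg_series_exp_coeff.
Qed.

Section Chain.
Variables (R : realType) (B : cstarAlg R).
Variable iota : forall V : {fset vertex}, locAlg R V -> B.
Hypothesis iota_lim : is_inductive_limit iota.
Variable Tr : {scalar B}.
Hypothesis Tr_trace : is_normalized_trace iota Tr.
Implicit Types (x y : vertex) (m : 'M[R[i]]_2) (P Q : set vertex) (a b c : B).
Local Notation at_ := (at_site iota).
Local Notation "'s_' x" := (at_site iota x (pauliZ R)) (at level 8, x at level 2).
Local Notation loc := (loc iota).
Local Notation spin_alg := (spin_alg iota).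

Definition child (e : vertex * 'I_2) : vertex := rcons e.1 e.2.

Lemma child_inj : injective child.
Proof. by move=> [x i] [y j] /rcons_inj[-> ->]. Qed.

(** An edge is given by its upper end and the letter leading to its lower end. *)
Definition level (n : nat) : seq (vertex * 'I_2) :=
  [seq (x, j) | x <- enum_fset (W n), j <- [:: 0; 1]].

Lemma mem_W n x : (x \in W n) = (size x == n).
Proof.
apply/imfsetP/eqP => [[t _ ->]|xn]; first by rewrite size_tuple.
by exists (tcast xn (in_tuple x)) => //=; rewrite val_tcast.
Qed.

Lemma mem_Lambda n x : (x \in Lambda n) = (size x <= n)%N.
Proof.
apply/bigfcupP/idP => [[k _]|xn]; first by rewrite mem_W => /eqP ->; rewrite -ltnS.
by exists (inord (size x)); rewrite ?mem_index_enum// mem_W inordK.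
Qed.

Lemma mem_level n e : (e \in level n) = (size e.1 == n).
Proof.
case: e => x j; rewrite -mem_W.
apply/allpairsP/idP => [[[u k]/= [uW _ [-> _]]] //|xW].
by exists (x, j); split=> //; rewrite !inE; clear; case: j => [[|[|]]].
Qed.

Lemma level_uniq n : uniq (level n).
Proof.
apply: allpairs_uniq => [||[x i] [y j] _ _ /= [-> ->] //]; last by [].
exact: fset_uniq.
Qed.

Fixpoint edges (n : nat) : seq (vertex * 'I_2) :=
  if n is n'.+1 then edges n' ++ level n' else [::].

Lemma mem_edges n e : (e \in edges n) = (size e.1 < n)%N.
Proof.
by elim: n => // n IH; rewrite mem_cat IH mem_level ltnS [RHS]leq_eqVlt orbC.
Qed.

Lemma edges_uniq n : uniq (edges n).
Proof.
elim: n => //= n IH; rewrite cat_uniq IH level_uniq andbT/=.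
apply/hasPn => e; rewrite mem_level => /eqP en.
by rewrite mem_edges en ltnn.
Qed.

Lemma prod_edges n (F : vertex * 'I_2 -> B) :
  \prod_(e <- edges n) F e =
  \prod_(m < n) \prod_(x : W m) (F (val x, 0) * F (val x, 1)).
Proof.
elim: n => [|n IH]; first by rewrite big_nil big_ord0.
rewrite big_ord_recr big_cat/= IH; congr (_ * _).
rewrite -(big_seq_fsetE _ _ xpredT (fun x => F (x, 0) * F (x, 1))) /level.
elim: (enum_fset _) => [|x r IHr] /=; first by rewrite !big_nil.
by rewrite !big_cons IHr mulrA.
Qed.

Section Gibbs.
Variable theta : R.

(** The weight of an edge, normalized so that its partial trace over either end
is 1. *)
Definition edge_factor (e : vertex * 'I_2) : B :=
  1 + theta%:C *: (s_ e.1 * s_ (child e)).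

Definition gibbs (s : seq (vertex * 'I_2)) : B := \prod_(e <- s) edge_factor e.

Lemma edge_factor_spin_alg P e : P e.1 -> P (child e) -> spin_alg P (edge_factor e).
Proof.
move=> Pe Pc; apply: spin_algD; first exact: spin_alg1.
by apply/spin_algZ/spin_algM; apply: spin_alg_site.
Qed.

Lemma gibbs_spin_alg P s :
  (forall e, e \in s -> P e.1 /\ P (child e)) -> spin_alg P (gibbs s).
Proof.
rewrite /gibbs; elim: s => [|e s IH] Ps; first by rewrite big_nil; exact: spin_alg1.
rewrite big_cons; apply: spin_algM.
  by have [] := Ps e (mem_head _ _); exact: edge_factor_spin_alg.
by apply: IH => e' e's; apply: Ps; rewrite inE e's orbT.
Qed.

Lemma trace_spin_at P y m b : loc P b -> ~ P y ->
  Tr (b * (at_ y m * s_ y)) = Tr b * (\tr (m *m pauliZ R) / 2).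
Proof.
by move=> Pb Py; rewrite -(atM iota_lim) (trace_at iota_lim Tr_trace _ Pb).
Qed.

Lemma trace_pauliZ : \tr (pauliZ R) = 0.
Proof.
by rewrite /mxtrace !big_ord_recl big_ord0 !mxE /= subr0 sub0r addr0 subrr.
Qed.

(** The lower end is free, and its spin has trace 0. *)
Lemma trace_edge_factor P e b : loc P b -> P e.1 -> ~ P (child e) ->
  Tr (b * edge_factor e) = Tr b.
Proof.
move=> Pb Pe Pc; rewrite mulrDr mulr1 linearD/= -scalerAr linearZ/= mulrA.
rewrite (trace_at iota_lim Tr_trace (P := P)) ?trace_pauliZ//.
  by rewrite mul0r !mulr0 addr0.
by apply: locM => //; apply: loc_at.
Qed.

(** Distinct edges of [s] have distinct lower ends, so after one of them has been
absorbed into [b] the others are still free. *)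
Lemma trace_gibbs P s b : loc P b -> uniq s ->
  (forall e, e \in s -> P e.1 /\ ~ P (child e)) ->
  Tr (b * gibbs s) = Tr b.
Proof.
rewrite /gibbs; elim: s P b => [|e s IH] P b Pb; first by rewrite big_nil mulr1.
move=> /andP[es us] Ps; rewrite big_cons mulrA.
have [Pe Pc] := Ps e (mem_head _ _).
rewrite (IH (P `|` [set child e])) ?(trace_edge_factor Pb)//.
  apply: locM => //; first by apply: locS Pb; exact: subsetUl.
  by apply/spin_alg_loc => //; apply: edge_factor_spin_alg; [left|right].
move=> e' e's; have [Pe' Pc'] := Ps e' (mem_behead (s := e :: s) e's).
split; first by left.
by case=> // /child_inj ee'; move: es; rewrite -ee' e's.
Qed.

Lemma trace_gibbs_level n b : loc [set v | (size v <= n)%N] b ->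
  Tr (b * gibbs (level n)) = Tr b.
Proof.
move=> nb; apply: (trace_gibbs nb (level_uniq n)) => e.
rewrite mem_level => /eqP en; split; rewrite /= ?size_rcons en ?leqnn//.
by rewrite ltnn.
Qed.

Lemma gibbs_edges_spin_alg n :
  spin_alg [set v | (size v <= n)%N] (gibbs (edges n)).
Proof.
apply: gibbs_spin_alg => e; rewrite mem_edges => en.
by rewrite /= size_rcons; split=> //; exact: ltnW.
Qed.

Lemma gibbs_edgesS n : gibbs (edges n.+1) = gibbs (edges n) * gibbs (level n).
Proof. by rewrite /gibbs big_cat. Qed.

Lemma trace_gibbs_edges n : Tr (gibbs (edges n)) = 1.
Proof.
elim: n => [|n IH].
  by rewrite /gibbs big_nil (state_one (trace_state Tr_trace)).
rewrite gibbs_edgesS trace_gibbs_level// ; apply: spin_alg_loc => //.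
exact: gibbs_edges_spin_alg.
Qed.

(** Among the edges down to the level of [child e], only [e] itself touches
[child e]. *)
Lemma gibbs_split e n : size e.1 = n -> exists2 g,
  spin_alg [set v | (size v <= n.+1)%N /\ v <> child e] g &
  gibbs (edges n.+1) = g * edge_factor e.
Proof.
move=> en; have es : e \in edges n.+1 by rewrite mem_edges en.
have := edges_uniq n.+1; have := mem_edges n.+1.
case/splitPr: es => s1 s2 sE; rewrite cat_uniq /= => /and3P[us1 us12 /andP[e2 us2]].
move: us12; rewrite negb_or => /andP[e1 _].
have diag s : {subset s <= s1 ++ e :: s2} -> e \notin s ->
    spin_alg [set v | (size v <= n.+1)%N /\ v <> child e] (gibbs s).
  move=> ss es; apply: gibbs_spin_alg => e' e's.
  have := ss _ e's; rewrite sE => e'n; split; split.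
  - exact: ltnW.
  - by move=> /(congr1 size); rewrite size_rcons en => h; rewrite h ltnn in e'n.
  - by rewrite /= size_rcons.
  - by move=> /child_inj ee; rewrite -ee e's in es.
have d1 := diag s1 _ e1; have d2 := diag s2 _ e2.
exists (gibbs s1 * gibbs s2).
  apply: spin_algM; [apply: d1 | apply: d2] => e' h;
    by rewrite mem_cat ?inE h ?orbT.
rewrite /gibbs big_cat big_cons/= -mulrA; congr (_ * _).
apply: (@spin_alg_comm _ _ _ iota_lim setT setT).
  exact: edge_factor_spin_alg.
exact: gibbs_spin_alg.
Qed.

End Gibbs.
End Chain.

(** * The Markov chain is the Gibbs state of the tree *)

Section Weights.
Variables (R : realType) (B : cstarAlg R).
Variable iota : forall V : {fset vertex}, locAlg R V -> B.
Hypothesis iota_lim : is_inductive_limit iota.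
Implicit Types (x y : vertex) (m : 'M[R[i]]_2) (P Q : set vertex) (a b c : B).
Local Notation at_ := (at_site iota).
Local Notation "'s_' x" := (at_site iota x (pauliZ R)) (at level 8, x at level 2).
Local Notation spin_alg := (spin_alg iota).

(** The two labels agree exactly when the product of the spins is 1. *)
Lemma edge_projE x y : edge_proj iota x y = 2^-1 *: (1 + s_ x * s_ y).
Proof.
have e0 : delta_mx 0 0 = 2^-1 *: (1%:M + pauliZ R) :> 'M[R[i]]_2.
  apply/matrixP => k l; rewrite !mxE.
  by case: k l => [[|[|]]//] ? [[|[|]]//] ? /=; field.
have e1 : delta_mx 1 1 = 2^-1 *: (1%:M - pauliZ R) :> 'M[R[i]]_2.
  apply/matrixP => k l; rewrite !mxE.
  by case: k l => [[|[|]]//] ? [[|[|]]//] ? /=; field.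
have atN z m : at_ z (- m) = - at_ z m.
  by rewrite -scaleN1r (atZ iota_lim) scaleN1r.
have p0 z : at_ z (delta_mx 0 0) = 2^-1 *: (1 + s_ z).
  by rewrite e0 (atZ iota_lim) (atD iota_lim _ 1%:M) (at1 iota_lim).
have p1 z : at_ z (delta_mx 1 1) = 2^-1 *: (1 - s_ z).
  by rewrite e1 (atZ iota_lim) (atD iota_lim _ 1%:M) (at1 iota_lim) atN.
rewrite /edge_proj !p0 !p1.
rewrite -!scalerAl -!scalerAr -!scalerDr scalerA.
have -> : (1 + s_ x) * (1 + s_ y) + (1 - s_ x) * (1 - s_ y)
    = (2 : R[i]) *: (1 + s_ x * s_ y).
  rewrite !mulrDl !mul1r !mulrDr !mulr1 mulrNN scaler_nat mulr2n.
  rewrite addrACA [X in X + _]addrACA subrr addr0.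
  by rewrite [X in _ + X]addrACA subrr add0r addrACA.
by rewrite scalerA -mulrA mulVf ?mulr1.
Qed.

Lemma spin_pair_sqr x y : (s_ x * s_ y) * (s_ x * s_ y) = 1.
Proof.
rewrite {1}(spin_comm iota_lim x y) mulrA -(mulrA (s_ y)) (spin_sqr iota_lim).
by rewrite mulr1 (spin_sqr iota_lim).
Qed.

Lemma edge_proj_idem x y :
  edge_proj iota x y * edge_proj iota x y = edge_proj iota x y.
Proof.
rewrite edge_projE -scalerAl -scalerAr mulrDl mul1r mulrDr mulr1 spin_pair_sqr.
have two w : w + w = (2 : R[i]) *: w :> B by rewrite scaler_nat mulr2n.
by rewrite [s_ x * s_ y + 1]addrC two !scalerA -mulrA mulVf// mulr1.
Qed.

Variable beta : R.
Let theta := (expR (2 * beta) - 1) / (expR (2 * beta) + 1).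

Lemma cexp_edge x y : cexp (beta%:C *: edge_proj iota x y)
  = 1 + (expR beta - 1)%:C *: edge_proj iota x y.
Proof. by apply: cexp_idempotent; exact: edge_proj_idem. Qed.

Lemma cexp_edge_spin_alg x y :
  spin_alg setT (cexp (beta%:C *: edge_proj iota x y)).
Proof.
rewrite cexp_edge edge_projE.
apply: spin_algD; first exact: spin_alg1.
apply: spin_algZ; have -> : 2^-1 = (2^-1)%:C :> R[i] by rewrite fmorphV rmorph_nat.
apply: spin_algZ; apply: spin_algD; first exact: spin_alg1.
by apply: spin_algM; apply: spin_alg_site.
Qed.

(** The numbers work out since [1 + (E - 1) p] with [p = (1 + s s')/2] is
[(E + 1)/2 + (E - 1)/2 s s']. *)
Lemma cexp_edge_sqr e (k := cexp (beta%:C *: edge_proj iota e.1 (child e))) :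
  k * k = ((expR (2 * beta) + 1) / 2)%:C *: edge_factor iota theta e.
Proof.
rewrite /k cexp_edge; set p := edge_proj _ _ _; set t := expR beta - 1.
have -> : (1 + t%:C *: p) * (1 + t%:C *: p) = 1 + (expR (2 * beta) - 1)%:C *: p.
  rewrite mulrDl mul1r mulrDr mulr1 -scalerAl -scalerAr edge_proj_idem.
  rewrite scalerA -addrA -!scalerDl -rmorphM -!rmorphD /=.
  have -> : 2 * beta = beta + beta by ring.
  by congr (1 + _%:C *: _); rewrite /t expRD; ring.
have e0 : expR (2 * beta) + 1 != 0 by rewrite gt_eqF// addr_gt0// expR_gt0.
have h2 : 2^-1 = (2^-1)%:C :> R[i] by rewrite fmorphV rmorph_nat.
rewrite /edge_factor /p edge_projE h2 /theta; set E := expR (2 * beta) in e0 *.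
rewrite !scalerDr !scalerA -!rmorphM/= addrA; congr (_ + _).
  have -> : (1 : B) + ((E - 1) * 2^-1)%:C *: 1
      = (1 : R)%:C *: 1 + ((E - 1) * 2^-1)%:C *: 1 by rewrite rmorph1 scale1r.
  by rewrite -scalerDl -rmorphD/=; congr (_%:C *: _); field.
by congr (_%:C *: _); field.
Qed.

Lemma prod_sqr (I : Type) (r : seq I) (F : I -> B) :
  (forall i, spin_alg setT (F i)) ->
  (\prod_(i <- r) F i) * (\prod_(i <- r) F i) = \prod_(i <- r) (F i * F i).
Proof.
move=> FP; elim: r => [|i r IH]; first by rewrite !big_nil mulr1.
rewrite !big_cons -IH -!mulrA; congr (_ * _); rewrite !mulrA; congr (_ * _).
apply: (spin_alg_comm iota_lim (P := setT) (Q := setT)) => //.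
by elim/big_ind: _ => //; [exact: spin_alg1|exact: spin_algM].
Qed.

Variables (w0 : 'M[R[i]]_2) (h : vertex -> 'M[R[i]]_2) (K : vertex -> vertex -> B).
Variables (cw ch : R).
Hypotheses (cw0 : 0 < cw) (ch0 : 0 < ch).
Hypothesis w0E : w0 = (cw%:C)%:M.
Hypothesis hE : forall x, h x = (ch%:C)%:M.
Hypothesis KE : forall x (i : 'I_2),
  K x (rcons x i) = cexp (beta%:C *: edge_proj iota x (rcons x i)).

(** The constant [Z] is left undetermined: it is fixed afterwards by the
normalization of the state. *)
Lemma calW_gibbs n : exists Z : R[i],
  calW iota w0 h K n = Z *: gibbs iota theta (edges n).
Proof.
pose F e := cexp (beta%:C *: edge_proj iota e.1 (child e)).
have FP e : spin_alg setT (F e) by exact: cexp_edge_spin_alg.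
have at_scalar x z : at_ x z%:M = z *: 1.
  by rewrite -(at1 iota_lim x) -(atZ iota_lim) scale_scalar_mx mulr1.
have [z KnE] : exists z : R[i], Kn iota w0 h K n = z *: \prod_(e <- edges n) F e.
  rewrite /Kn w0E sqrtm_scalar// at_scalar -scalerAl mul1r.
  have -> : \prod_(m < n) \prod_(x : W m)
      (K (val x) (rcons (val x) 0) * K (val x) (rcons (val x) 1))
      = \prod_(e <- edges n) F e.
    rewrite prod_edges; apply: eq_bigr => m _; apply: eq_bigr => x _.
    by rewrite !KE.
  have [z ->] : exists z : R[i],
      \prod_(x : W n) at_ (val x) (sqrtm (h (val x))) = z *: 1.
    elim/big_ind: _ => [|_ _ [z ->] [z' ->]|x _].
    - by exists 1; rewrite scale1r.
    - by exists (z * z'); rewrite -scalerAl mul1r scalerA.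
    - by rewrite hE sqrtm_scalar// at_scalar; eexists.
  by eexists; rewrite -scalerAr mulr1 scalerA.
pose kap : R[i] := ((expR (2 * beta) + 1) / 2)%:C.
exists (Num.conj z * z * kap ^+ size (edges n)).
rewrite /calW KnE starZ -scalerAl -scalerAr scalerA.
have -> : star (\prod_(e <- edges n) F e) = \prod_(e <- edges n) F e.
  apply: (spin_alg_star iota_lim (P := setT)).
  elim/big_ind: _ => //; [exact: spin_alg1|exact: spin_algM].
rewrite prod_sqr// -[in RHS]scalerA; congr (_ *: _).
rewrite /gibbs; elim: (edges n) => [|e s IH]; first by rewrite !big_nil scale1r.
rewrite !big_cons IH cexp_edge_sqr exprS -scalerAl -scalerAr scalerA //.
Qed.

Variable Tr : {scalar B}.
Hypothesis Tr_trace : is_normalized_trace iota Tr.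
Variable phi : {scalar B}.
Hypothesis phi_chain : is_markov_chain iota w0 h K Tr phi.

(** Evaluating both sides at 1 shows that the constant is 1, because Gibbs
products have trace 1; the edges from level [n] to level [n + 1] are then
integrated out. *)
Lemma markov_chain_gibbs n b : loc iota [set v | (size v <= n)%N] b ->
  phi b = Tr (b * gibbs iota theta (edges n)).
Proof.
move=> nb.
have phiE c : loc iota [set v | (size v <= n)%N] c ->
    phi c = Tr (calW iota w0 h K n.+1 * c).
  move=> [V Vn Vc]; have VL : (V `<=` Lambda n)%fset.
    by apply/fsubsetP => v /Vn /=; rewrite mem_Lambda.
  have [a ->] := flocS iota_lim VL Vc.
  exact: chain_loc.
have [Z ZE] := calW_gibbs n.+1.
have Z1 : Z = 1.
  have := phiE 1 (loc1 iota_lim _).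
  rewrite (state_one (chain_state phi_chain)) mulr1 ZE linearZ.
  by rewrite (trace_gibbs_edges iota_lim Tr_trace) => ->; rewrite [RHS]mulr1.
rewrite phiE// ZE Z1 scale1r.
have gn := gibbs_edges_spin_alg iota theta n.
rewrite (trace_comm iota_lim Tr_trace (P := setT)); first last.
- exact: locS nb.
- apply: spin_alg_loc => //; apply: spin_algS (gibbs_edges_spin_alg _ _ _) => //.
rewrite gibbs_edgesS mulrA (trace_gibbs_level iota_lim Tr_trace)//.
by apply: locM => //; apply: spin_alg_loc.
Qed.

End Weights.

(** * Leaf removal *)

Section LeafRemoval.
Variables (R : realType) (B : cstarAlg R).
Variable iota : forall V : {fset vertex}, locAlg R V -> B.
Hypothesis iota_lim : is_inductive_limit iota.
Variable Tr : {scalar B}.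
Hypothesis Tr_trace : is_normalized_trace iota Tr.
Variable theta : R.
Implicit Types (x y : vertex) (m : 'M[R[i]]_2) (P Q : set vertex) (a b c : B).
Local Notation at_ := (at_site iota).
Local Notation "'s_' x" := (at_site iota x (pauliZ R)) (at level 8, x at level 2).
Local Notation spin_alg := (spin_alg iota).
Local Notation loc := (loc iota).

(** The conditional expectation of a matrix at a vertex, seen from the parent. *)
Definition transfer m : 'M[R[i]]_2 :=
  (\tr m / 2)%:M + (theta%:C * (\tr (m *m pauliZ R) / 2)) *: pauliZ R.

(** The size condition ensures that [rcons x j] is a leaf of the region where [b]
lives; the other vertices on its level may be occupied. *)
Definition leaf_removal (psi : B -> R[i]) := forall b x j m,
  loc [set v | (size v <= (size x).+1)%N /\ v <> rcons x j] b ->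
  psi (b * at_ (rcons x j) m) = psi (b * at_ x (transfer m)).

Lemma at_transfer x m : at_ x (transfer m) =
  (\tr m / 2) *: 1 + (theta%:C * (\tr (m *m pauliZ R) / 2)) *: s_ x.
Proof.
rewrite /transfer (atD iota_lim) (atZ iota_lim) -[X in at_ x X%:M]mulr1.
by rewrite -scale_scalar_mx (atZ iota_lim) (at1 iota_lim).
Qed.

Lemma transfer_spin (u w : R[i]) : transfer (u%:M + w *: pauliZ R) =
  u%:M + (theta%:C * w) *: pauliZ R.
Proof.
have ZZ : pauliZ R *m pauliZ R = 1%:M.
  apply/matrixP => k l; rewrite mxE !big_ord_recl big_ord0 !mxE.
  by case: k l => [[|[|]]//] ? [[|[|]]//] ? /=; ring.
rewrite /transfer mulmxDl mul_scalar_mx -scalemxAl ZZ !mxtraceD !mxtraceZ.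
rewrite trace_pauliZ mxtrace1 mxtrace_scalar !mulr0 addr0 add0r.
by congr (_%:M + (_ * _) *: _); field.
Qed.

Lemma transfer_iter k m : iter k.+1 transfer m =
  (\tr m / 2)%:M + (theta%:C ^+ k.+1 * (\tr (m *m pauliZ R) / 2)) *: pauliZ R.
Proof.
elim: k => [|k IH]; first by rewrite expr1.
by rewrite iterS IH transfer_spin mulrA -exprS.
Qed.

Let TrD b c : Tr (b + c) = Tr b + Tr c.
Proof. exact: linearD. Qed.
Let TrZ (z : R[i]) b : Tr (z *: b) = z * Tr b.
Proof. exact: linearZ. Qed.

(** Let [e] be the edge from [x] to its child [y].  The Gibbs product is
[g (1 + theta s_x s_y)] with [g] not touching [y].  On the left-hand side the
trace over [y] leaves [tr m / 2 + theta (tr (m s) / 2) s_x], which is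
[transfer m] at [x]; on the right-hand side it removes the edge factor. *)
Lemma trace_leaf_removal (phi : {scalar B}) :
  (forall n b, loc [set v | (size v <= n)%N] b ->
     phi b = Tr (b * gibbs iota theta (edges n))) -> leaf_removal phi.
Proof.
move=> phiE b x j m Pb; set y := rcons x j.
have sy : size y = (size x).+1 by rewrite size_rcons.
pose e := (x, j).
have [g Pg gE] := gibbs_split iota_lim theta (erefl (size e.1)).
set P := [set v | _] in Pb; change (spin_alg P g) in Pg.
have gP := spin_alg_loc iota_lim Pg.
have Py : ~ P y by case.
have Px : P x.
  by split; [exact: leqW | move=> /(congr1 size); rewrite size_rcons; exact: n_Sn].
have PsubN : P `<=` [set v | (size v <= (size x).+1)%N] by move=> v [].
have bN := locS PsubN Pb.
rewrite !(phiE (size x).+1); last 2 first.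
- by apply: locM => //; apply: loc_at => //=; exact: leqW.
- by apply: locM => //; apply: loc_at => //=; rewrite size_rcons.
have sx m' : loc P (at_ x m') by apply: loc_at.
rewrite gE !mulrA.
rewrite [RHS](trace_edge_factor iota_lim Tr_trace theta _ Px Py); last first.
  by do 2!apply: locM => //.
have bg := locM iota_lim Pb gP.
have -> : b * at_ y m * g = b * g * at_ y m.
  by rewrite -mulrA -(at_comm iota_lim m gP Py) mulrA.
rewrite /edge_factor /= -/y mulrDr mulr1 -scalerAr TrD TrZ.
have -> : b * g * at_ y m * (s_ x * s_ y) = b * g * s_ x * (at_ y m * s_ y).
  rewrite mulrA -(mulrA (b * g)).
  by rewrite -(at_comm iota_lim m (sx _) Py) !mulrA.
rewrite (trace_spin_at iota_lim Tr_trace m _ Py); last exact: locM.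
rewrite (trace_at iota_lim Tr_trace m bg Py).
rewrite at_transfer mulrDr -!scalerAr mulr1 mulrDl -!scalerAl TrD !TrZ.
have -> : b * s_ x * g = b * g * s_ x.
  rewrite -!mulrA; congr (_ * _).
  by apply: (spin_alg_comm iota_lim (P := P) (Q := P)) => //; exact: spin_alg_site.
by rewrite /GRing.scale/=; ring.
Qed.

Lemma trace_root (phi : {scalar B}) :
  (forall n b, loc [set v | (size v <= n)%N] b ->
     phi b = Tr (b * gibbs iota theta (edges n))) ->
  forall m, phi (at_ [::] m) = \tr m / 2.
Proof.
move=> phiE m; rewrite (phiE 0%N); last exact: loc_at.
rewrite /gibbs big_nil mulr1 -[at_ _ _]mul1r.
rewrite (trace_at iota_lim Tr_trace m (loc1 iota_lim set0))//.
by rewrite (state_one (trace_state Tr_trace)) mul1r.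
Qed.

Lemma loc_floc V b : loc [set v | v \in V] b -> floc iota V b.
Proof. by move=> [U UV Ub]; apply: flocS Ub => //; apply/fsubsetP. Qed.

(** Induction on the sum of the lengths of the vertices in the support: a vertex
of maximal length is replaced by its parent, through the decomposition over the
matrix units at that vertex.  The matrix is built from these decompositions,
before any [psi] is given. *)
Lemma reduce_to_root a : loc setT a -> exists m, forall psi : B -> R[i],
  {morph psi : u v / u + v} -> leaf_removal psi -> psi a = psi (at_ [::] m).
Proof.
move=> [V _ Va].
have [n] := ubnP (\sum_(v <- V) size v); elim: n => // n IH in V a Va *.
move=> Vn; case: (pselect (exists2 y, y \in V & (0 < size y)%N)); last first.
  move=> V0; have : floc iota [fset [::]]%fset a.
    apply: (flocS iota_lim) Va; apply/fsubsetP => v vV; rewrite inE.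
    by rewrite -size_eq0 eqn0Ngt; apply/negP => v0; apply: V0; exists v.
  by case/(floc1 (iota := iota)) => m ->; exists m.
move=> [y0 y0V y0_gt0].
have [y yV ymax] : exists2 y, y \in V & forall v, v \in V -> (size v <= size y)%N.
  pose w := [arg max_(v > [` y0V]%fset) size (val v)].
  exists (val w); first exact: fsvalP.
  move=> v vV; rewrite /w; case: arg_maxnP => // u _ /(_ [` vV]%fset); exact.
have y_gt0 : (0 < size y)%N := leq_trans y0_gt0 (ymax _ y0V).
have [f fU aE] := floc_decomp iota_lim yV Va.
case/lastP: y => [|x j] // in yV ymax y_gt0 f fU aE *.
set U := (V `\ _)%fset in fU.
pose c := \sum_k \sum_l f k l * at_ x (transfer (delta_mx k l)).
have ac (psi : B -> R[i]) : {morph psi : u v / u + v} -> leaf_removal psi ->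
    psi a = psi c.
  move=> psiD psiL; have psi0 : psi 0 = 0.
    have /eqP := psiD 0 0.
    by rewrite addr0 -subr_eq subrr eq_sym => /eqP.
  rewrite aE /c !(big_morph psi psiD psi0); apply: eq_bigr => k _.
  rewrite !(big_morph psi psiD psi0); apply: eq_bigr => l _.
  apply: psiL; exists U => // v; rewrite !inE => /andP[/eqP vy vV].
  by split=> //; rewrite -(size_rcons x j); exact: ymax.
have c_loc : floc iota (x |` U)%fset c.
  apply: loc_floc; apply: (loc_sum iota_lim) => k.
  apply: (loc_sum iota_lim) => l; apply: (locM iota_lim).
    by exists U => // v vU; rewrite /= inE vU orbT.
  by apply: loc_at; rewrite /= fset1U1.
have lt : (\sum_(v <- (x |` U)%fset) size v < \sum_(v <- V) size v)%N.
  rewrite (big_fsetD1 _ yV) /= -/U size_rcons.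
  have [xU|xU] := boolP (x \in U).
    by rewrite mem_fset1U// addSn ltnS leq_addl.
  by rewrite big_fsetU1//= addSn.
have [m mE] := IH _ _ c_loc (leq_trans lt Vn).
by exists m => psi psiD psiL; rewrite ac// mE.
Qed.

End LeafRemoval.

(** * Invariance and clustering *)

Section Clustering.
Variables (R : realType) (B : cstarAlg R).
Variable iota : forall V : {fset vertex}, locAlg R V -> B.
Hypothesis iota_lim : is_inductive_limit iota.
Variable theta : R.
Variable phi : {scalar B}.
Hypothesis phi_leaf : leaf_removal iota theta phi.
Hypothesis phi_root : forall m, phi (at_site iota [::] m) = \tr m / 2.
Variables (i : 'I_2) (gamma : {lrmorphism B -> B}).
Hypothesis gamma_shift : is_shift iota i gamma.
Implicit Types (x y : vertex) (m : 'M[R[i]]_2) (P Q : set vertex) (a b c : B).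
Local Notation at_ := (at_site iota).
Local Notation loc := (loc iota).
Local Notation T := (transfer theta).

Lemma shift_loc P b : loc P b ->
  loc [set v | exists2 x, P x & v = i :: x] (gamma b).
Proof.
move=> [V VP Vb]; apply: locS (shift_floc iota_lim gamma_shift Vb).
by move=> v [x xV ->]; exists x => //; exact: VP.
Qed.

Lemma shift_iter_loc n P b : loc P b ->
  loc [set v | exists2 x, P x & v = nseq n i ++ x] (iter n gamma b).
Proof.
move=> Pb; elim: n => [|n IH] /=; first by apply: locS Pb => x; exists x.
by apply: locS (shift_loc IH) => v [_ [x Px ->] ->]; exists x.
Qed.

Lemma shift_iter_at n x m : iter n gamma (at_ x m) = at_ (nseq n i ++ x) m.
Proof. by elim: n => //= n ->; rewrite (shift_site gamma_shift). Qed.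

Lemma shift_iterM n a b : iter n gamma (a * b) = iter n gamma a * iter n gamma b.
Proof. by elim: n => //= n ->; rewrite rmorphM. Qed.

Lemma shift_iterD n a b : iter n gamma (a + b) = iter n gamma a + iter n gamma b.
Proof. by elim: n => //= n ->; rewrite raddfD. Qed.

(** The shifted sites lie at depth at least [n], below the support of [b], so [b]
can be moved past them and counted among the sites that are not below the removed
leaf. *)
Lemma shifted_leaf_removal N n b : (N < n)%N ->
  loc [set v | (size v <= N)%N] b ->
  leaf_removal iota theta (fun a => phi (iter n gamma a * b)).
Proof.
move=> Nn Nb c x j m Pc; rewrite !shift_iterM !shift_iter_at -!mulrA.
have far y m' : (size y >= n)%N -> at_ y m' * b = b * at_ y m'.
  move=> ny; apply/esym; apply: (at_comm iota_lim _ Nb) => /= yN.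
  by have := leq_trans Nn (leq_trans ny yN); rewrite ltnn.
rewrite !far ?size_cat ?size_nseq ?leq_addr// !mulrA -rcons_cat.
apply: phi_leaf; apply: (locM iota_lim).
  apply: (locS _ (shift_iter_loc n Pc)) => v [u [ux uxj] ->]; split.
    by rewrite !size_cat -addnS leq_add2l.
  by rewrite rcons_cat => /eqP; rewrite eqseq_cat// eqxx/= => /eqP.
apply: (locS _ Nb) => v /= vN.
have vn : (size v < size (rcons (nseq n i ++ x) j))%N.
  rewrite size_rcons size_cat size_nseq ltnS (leq_trans vN)//.
  by rewrite (leq_trans (ltnW Nn))// leq_addr.
by split; [rewrite -(size_rcons _ j) ltnW | move=> vE; rewrite vE ltnn in vn].
Qed.

(** Leaf removal along the ray of the letter [i], from depth [N + k] up to depth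
[N]. *)
Lemma leaf_removal_path N k b m : loc [set v | (size v <= N)%N] b ->
  phi (b * at_ (nseq (N + k) i) m) = phi (b * at_ (nseq N i) (iter k T m)).
Proof.
move=> Nb; elim: k m => [|k IH] m; first by rewrite addn0.
have -> : nseq (N + k.+1) i = rcons (nseq (N + k) i) i.
  by rewrite addnS -cats1 -(nseqD _ 1) addn1.
rewrite phi_leaf ?IH -?iterSr// size_nseq.
apply: locS Nb => v /= vN; split.
  by rewrite (leq_trans vN)// ltnW// ltnS leq_addr.
by move=> vE; move: vN; rewrite vE size_rcons size_nseq leqNgt ltnS leq_addr.
Qed.

(** The matrix at the root to which [a] reduces serves both for [phi] itself and
for the functional of the shifted elements. *)
Lemma shifted_correlation a : loc setT a -> exists2 m, phi a = \tr m / 2 &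
  forall N b k, loc [set v | (size v <= N)%N] b ->
    phi (iter (N + k.+1) gamma a * b) =
    phi a * phi b + theta%:C ^+ k.+1 *
      (\tr (m *m pauliZ R) / 2 * phi (b * at_ (nseq N i) (pauliZ R))).
Proof.
move=> /(reduce_to_root iota_lim theta)[m mE].
have phiD : {morph phi : u v / u + v} by exact: linearD.
have aE : phi a = \tr m / 2 by rewrite mE.
exists m => // N b k Nb.
have Nn : (N < N + k.+1)%N by rewrite addnS ltnS leq_addr.
rewrite (mE (fun a => phi (iter (N + k.+1) gamma a * b))); first last.
- exact: shifted_leaf_removal Nb.
- by move=> u v; rewrite shift_iterD mulrDl phiD.
rewrite shift_iter_at cats0 -(at_comm iota_lim m Nb); last first.
  by rewrite /= size_nseq => /(leq_trans Nn); rewrite ltnn.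
rewrite leaf_removal_path// transfer_iter (atD iota_lim) (atZ iota_lim) mulrDr phiD.
rewrite -[X in at_ _ X%:M]mulr1 -scale_scalar_mx (atZ iota_lim) (at1 iota_lim).
have phiZ z c : phi (z *: c) = z * phi c by exact: linearZ.
by rewrite -!scalerAr mulr1 !phiZ aE /GRing.scale/=; ring.
Qed.

(** The correlation formula with [b = 1]: the correction term contains the spin at
the root, whose expectation is 0. *)
Lemma local_invariance a : loc setT a -> phi (gamma a) = phi a.
Proof.
move=> la; have [m aE mE] := shifted_correlation la.
have := mE 0%N 1 0%N (loc1 iota_lim _).
have phi1 : phi 1 = 1.
  by rewrite -(at1 iota_lim [::]) phi_root mxtrace1 mulfV.
by rewrite /= mul1r phi1 !mulr1 phi_root trace_pauliZ mul0r !mulr0 addr0.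
Qed.

Lemma local_clustering a b : `|theta| < 1 -> loc setT a -> loc setT b ->
  (fun n => phi (iter n gamma a * b) : R[i]^o) @ \oo
      --> (phi a * phi b : R[i]^o).
Proof.
move=> theta1 la [V _ Vb].
have [N Nb] : exists N, loc [set v | (size v <= N)%N] b.
  exists (\max_(v <- V) size v)%N; exists V => // v vV /=.
  exact: leq_bigmax_seq.
have [m _ mE] := shifted_correlation la.
rewrite -(cvg_shiftn N.+1) /=.
under eq_fun do rewrite addnC addSnnS mE//.
set c := _ / 2 * phi _.
suff : (fun n => phi a * phi b + theta%:C ^+ n.+1 * c : R[i]^o) @ \oo
    --> (phi a * phi b + 0 * c : R[i]^o) by rewrite mul0r addr0.
apply: cvgD; first exact: cvg_cst.
apply: cvgMr_tmp.
under eq_fun do rewrite -rmorphXn.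
apply: cvg_realC.
rewrite (cvg_shiftS (fun n => theta ^+ n)).
exact: cvg_expr.
Qed.

End Clustering.

Section Density.
Variables (R : realType) (B : cstarAlg R).
Variable iota : forall V : {fset vertex}, locAlg R V -> B.
Hypothesis iota_lim : is_inductive_limit iota.
Variable phi : {scalar B}.
Hypothesis phi_state : is_state phi.
Variable gamma : {lrmorphism B -> B}.
Hypothesis gamma_star : forall a : B, gamma (star a) = star (gamma a).
Implicit Types a b c : B.
Local Notation loc := (loc iota).

Lemma state_comp_star : is_state (phi \o gamma : {scalar B}).
Proof.
split=> [a|] /=; last by rewrite rmorph1 (state_one phi_state).
have -> : gamma (star a * a) = star (gamma a) * gamma a.
  by rewrite rmorphM/= gamma_star.
exact: (state_pos phi_state).
Qed.

Lemma state_eq_local (psi : {scalar B}) : is_state psi ->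
  (forall a, loc setT a -> psi a = phi a) -> forall a, psi a = phi a.
Proof.
move=> psi_state local a; apply/eqP; rewrite -subr_eq0; apply/eqP.
apply: (@norm_eq0_eps _ _ 16) => // e e0.
have [b lb ab] := loc_dense iota_lim a e0.
have -> : psi a - phi a = psi (a - b) - phi (a - b).
  have sub (f : {scalar B}) : f (a - b) = f a - f b by exact: linearB.
  by rewrite !sub (local b lb) opprB addrA subrK.
rewrite (le_trans (ler_normB _ _))//.
rewrite (le_trans (lerD (state_bound psi_state _) (state_bound phi_state _)))//.
by rewrite -mulrDl ler_pM ?(ltW ab)//; have -> : 8 + 8 = 16 :> R[i] by ring.
Qed.

Hypothesis phi_inv : forall a, phi (gamma a) = phi a.

(** After normalization the Schwarz inequality applies, and the shift drops out of
[phi (gamma^n a (gamma^n a)^* )] by invariance; the bound is uniform in [n]. *)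
Lemma correlation_bound n a b : `|phi (iter n gamma a * b)| <= 16 * `|a| * `|b|.
Proof.
have iterZ z c : iter n gamma (z *: c) = z *: iter n gamma c.
  by elim: n => //= n ->; rewrite linearZ.
have inv c : phi (iter n gamma c * star (iter n gamma c)) = phi (c * star c).
  elim: n {iterZ} => //= n IH.
  by rewrite -gamma_star -[gamma _ * _](rmorphM gamma) phi_inv.
have [->|a0] := eqVneq a 0.
  have -> : iter n gamma 0 = 0 by rewrite -(scale0r 0) iterZ !scale0r.
  by rewrite mul0r linear0 !normr0 mulr0 mul0r.
have [->|b0] := eqVneq b 0.
  by rewrite mulr0 linear0 !normr0 mulr0.
have unit_ball c d : `|c| = 1 -> `|d| = 1 -> `|phi (iter n gamma c * d)| <= 16.
  move=> c1 d1; rewrite (le_trans (state_Schwarz phi_state _ _))//.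
  rewrite inv.
  have small u : `|u| = 1 -> phi (star u * u) <= 8.
    move=> u1; rewrite (le_trans (real_ler_norm _))//.
      by rewrite ger0_real// (state_pos phi_state).
    by rewrite (le_trans (state_bound phi_state _))// norm_starM u1 expr1n mulr1.
  have -> : 16 = 8 + 8 :> R[i] by ring.
  rewrite lerD ?small// -{1}[c]starK small// norm_star//.
have nrm c : c != 0 -> `|(`|c|^-1 *: c)| = 1.
  by move=> c0; rewrite normrZ normfV normr_id mulVf// normr_eq0.
have := unit_ball _ _ (nrm a a0) (nrm b b0).
rewrite iterZ -scalerAl -scalerAr scalerA linearZ/= normrM normrM !normfV !normr_id.
rewrite -invfM ler_pdivrMl ?mulr_gt0 ?normr_gt0// => h.
by apply: (le_trans h); rewrite le_eqVlt; apply/orP; left; apply/eqP; ring.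
Qed.

(** Both sides are bilinear and bounded uniformly in [n], so the two arguments can
be approximated by local elements one after the other. *)
Lemma clustering_dense :
  (forall a b, loc setT a -> loc setT b ->
    (fun n => phi (iter n gamma a * b) : R[i]^o) @ \oo
      --> (phi a * phi b : R[i]^o)) ->
  forall a b,
    (fun n => phi (iter n gamma a * b) : R[i]^o) @ \oo
      --> (phi a * phi b : R[i]^o).
Proof.
move=> local.
have prod_bound c d : `|phi c * phi d| <= 64 * `|c| * `|d|.
  rewrite normrM (le_trans (ler_pM _ _ (state_bound phi_state c)
    (state_bound phi_state d)))//.
  by have -> : 8 * `|c| * (8 * `|d|) = 64 * `|c| * `|d| by ring.
have iterB n c d : iter n gamma (c - d) = iter n gamma c - iter n gamma d.
  by elim: n => //= n ->; rewrite raddfB.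
have le64 (c d : B) : 16 * `|c| * `|d| <= 64 * `|c| * `|d| :> R[i].
  by rewrite !ler_wpM2r// ler_nat.
have half a b : loc setT b ->
    (fun n => phi (iter n gamma a * b) : R[i]^o) @ \oo
      --> (phi a * phi b : R[i]^o).
  move=> lb; apply: (@cvg_approx _ _ _ (64 * `|b|)); first exact: mulr_ge0.
  move=> e e0; have [a' la' aa'] := loc_dense iota_lim a e0.
  have le_e : 64 * `|a - a'| * `|b| <= 64 * `|b| * e.
    by rewrite mulrAC ler_wpM2l ?mulr_ge0// ltW.
  exists (fun n => phi (iter n gamma a' * b)), (phi a' * phi b).
  split=> [|n|]; first exact: local.
    rewrite -linearB -mulrBl -iterB (le_trans (correlation_bound _ _ _))//.
    exact: le_trans (le64 _ _) le_e.
  by rewrite -mulrBl -linearB (le_trans (prod_bound _ _)).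
move=> a b; apply: (@cvg_approx _ _ _ (64 * `|a|)); first exact: mulr_ge0.
move=> e e0; have [b' lb' bb'] := loc_dense iota_lim b e0.
have le_e : 64 * `|a| * `|b - b'| <= 64 * `|a| * e.
  by rewrite ler_wpM2l ?mulr_ge0// ltW.
exists (fun n => phi (iter n gamma a * b')), (phi a * phi b').
split=> [|n|]; first exact: half.
  rewrite -linearB -mulrBr (le_trans (correlation_bound _ _ _))//.
  exact: le_trans (le64 _ _) le_e.
by rewrite -mulrBr -linearB (le_trans (prod_bound _ _)).
Qed.

End Density.

Theorem theorem8p1 (R : realType) (B : cstarAlg R)
    (iota : forall V : {fset vertex}, locAlg R V -> B)
    (Hiota : is_inductive_limit iota)
    (Tr : {scalar B}) (HTr : is_normalized_trace iota Tr)
    (gamma : 'I_2 -> {lrmorphism B -> B})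
    (Hgamma : forall i : 'I_2, is_shift iota i (gamma i))
    (beta : R) (w0 : 'M[R[i]]_2) (h : vertex -> 'M[R[i]]_2)
    (K : vertex -> vertex -> B)
    (Hw0 : w0 = (((expR (2 * beta) + 1) ^+ 2 / 4)%:C)%:M)
    (Hh : forall x : vertex, h x = ((4 / (expR (2 * beta) + 1) ^+ 2)%:C)%:M)
    (HK : forall (x : vertex) (i : 'I_2),
        K x (rcons x i) = cexp (beta%:C *: edge_proj iota x (rcons x i)))
    (phi : {scalar B}) (Hphi : is_markov_chain iota w0 h K Tr phi) :
  (forall (i : 'I_2) (a : B), phi (gamma i a) = phi a)
  /\ (forall (i : 'I_2) (a b : B),
        (fun n : nat => phi (iter n (gamma i) a * b) : R[i]^o) @ \oo
          --> (phi a * phi b : R[i]^o)).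
Proof.
have E0 : 0 < expR (2 * beta) + 1 by rewrite addr_gt0// expR_gt0.
have w0_gt0 : 0 < (expR (2 * beta) + 1) ^+ 2 / 4 by rewrite divr_gt0// exprn_gt0.
have h_gt0 : 0 < 4 / (expR (2 * beta) + 1) ^+ 2 by rewrite divr_gt0// exprn_gt0.
have phiE := markov_chain_gibbs Hiota w0_gt0 h_gt0 Hw0 Hh HK HTr Hphi.
have phi_leaf := trace_leaf_removal Hiota HTr phiE.
have phi_root := trace_root Hiota HTr phiE.
have phi_state := chain_state Hphi.
have invariant i a : phi (gamma i a) = phi a.
  have star_i := shift_star (Hgamma i).
  apply: (state_eq_local Hiota phi_state (state_comp_star phi_state star_i)).
  exact: (local_invariance Hiota phi_leaf phi_root (Hgamma i)).
split=> // i.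
apply: (clustering_dense Hiota phi_state (shift_star (Hgamma i))) => //.
move=> a b; apply: (local_clustering Hiota phi_leaf phi_root (Hgamma i)).
rewrite normrM normfV (gtr0_norm E0) ltr_pdivrMr// mul1r.
by rewrite ltr_norml; have := expR_gt0 (2 * beta); lra.
Qed.
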